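(* Let $(M,g)$ be a compact Riemannian manifold with smooth boundary $\partial M$, let $\eta\in\Omega^1(M)$ be a real smooth $1$-form and let $f\in C^\infty(M,\mathbb{C})$ satisfy $\Delta^\eta f=0$. Then the function $|f|\ge 0$ on $M$ assumes its maximum at a point of $\partial M$.
   Context: Manifolds are connected and $\partial M\neq\emptyset$. For a real $1$-form $\eta$ (the magnetic potential), the magnetic differential is $d^\eta f:=d^Mf+if\eta$ for complex-valued functions $f$, and the magnetic co-differential is $\delta^\eta\omega:=\delta^M\omega-i\,\eta\lrcorner\omega$ for complex $1$-forms $\omega$, where $\delta^M$ is the formal adjoint of $d^M$ and $\eta\lrcorner$ is contraction with the vector field $\eta^\sharp$ dual to $\eta$. The magnetic Laplacian is $\Delta^\eta f:=\delta^\eta(d^\eta f)=\Delta^Mf-2i\,\eta^\sharp(f)+(i\delta^M\eta+|\eta|^2)f$, where $\Delta^M=\delta^Md^M$ is the non-negative Laplacian. *)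

(* Defs.v *)
From mathcomp Require Import all_boot all_order all_algebra.
From mathcomp Require Import all_classical all_reals all_analysis.
From mathcomp Require Import complex.

Set Implicit Arguments.
Unset Strict Implicit.
Unset Printing Implicit Defensive.

Import Order.TTheory GRing.Theory Num.Theory.
Import numFieldNormedType.Exports.

Local Open Scope classical_set_scope.
Local Open Scope ring_scope.
Local Open Scope complex_scope.

Section HalfSpaceCalculus.
Context {R : realType} {n : nat}.
Local Notation E := 'rV[R]_n.+1.

Definition halfspace : set E := [set x | 0 <= x ord0 ord0].

Definition basis_vec (a : 'I_n.+1) : E := delta_mx ord0 a.

Definition iter_partial (s : seq 'I_n.+1) (F : E -> R) : E -> R :=
  foldr (fun a G x => 'D_(basis_vec a) G x) F s.

Definition smooth_open (W : set E) (F : E -> R) :=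
  forall s x, W x -> differentiable (iter_partial s F) x.

(* Smoothness on an arbitrary subset of R^(n+1): local existence of smooth
   extensions to open sets. *)
Definition smooth_on (A : set E) (F : E -> R) :=
  forall x, A x -> exists W G,
    [/\ open W, W x, smooth_open W G & forall y, A y -> W y -> F y = G y].

(* Partial derivative of a function on (a relatively open subset of) the
   half-space: only increments that stay in the half-space are used, so that at
   a boundary point the derivative in direction 0 is one-sided, and at an
   interior point this is the usual partial derivative. *)
Definition pderiv (a : 'I_n.+1) (u : E -> R) (x : E) : R :=
  lim ((fun h : R => h^-1 * (u (x + h *: basis_vec a) - u x))
         @ within [set h | halfspace (x + h *: basis_vec a)] 0^').

End HalfSpaceCalculus.

(* Integral over R^n, as an iterated one-dimensional Lebesgue integral. It is
   only applied to bounded Borel functions with compact support, for which this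
   is the n-dimensional Lebesgue integral (Fubini). *)
Fixpoint iter_integral {R : realType} (n : nat) : ('rV[R]_n -> R) -> R :=
  match n with
  | 0 => fun f => f 0
  | m.+1 => fun f => \int[@lebesgue_measure R]_t
      iter_integral (fun y : 'rV[R]_m => f (row_mx (t%:M : 'rV[R]_1) y))
  end.

(* Smooth atlas of an (n+1)-dimensional manifold with boundary. The maps
   [coord i] and [param i] are total functions, meaningful only on [dom i] and
   on its image. *)
Record atlas (R : realType) (n : nat) (M : topologicalType) := Atlas {
  chart : Type;
  dom : chart -> set M;
  coord : chart -> M -> 'rV[R]_n.+1;
  param : chart -> 'rV[R]_n.+1 -> M;
  chart_at : M -> chart;
  dom_chart_at : forall p, dom (chart_at p) p;
  dom_open : forall i, open (dom i);
  image_open : forall i, exists2 W, open W & coord i @` dom i = W `&` halfspace;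
  coordK : forall i p, dom i p -> param i (coord i p) = p;
  coord_continuous : forall i, {within dom i, continuous (coord i)};
  param_continuous : forall i,
    {within coord i @` dom i, continuous (param i)};
  transition_smooth : forall i j b, smooth_on (coord i @` (dom i `&` dom j))
    (fun x => coord j (param i x) ord0 b)
}.

Section Manifold.
Context {R : realType} {n : nat} {M : topologicalType} (A : atlas R n M).
Local Notation I := (chart A).

Definition boundary : set M :=
  [set p | exists2 i : I, dom i p & coord i p ord0 ord0 = 0].

Definition smooth_fun (u : M -> R) :=
  forall i : I, smooth_on (coord i @` dom i) (u \o param i).

Definition smooth_cfun (f : M -> R[i]) :=
  smooth_fun (@complex.Re R \o f) /\ smooth_fun (@complex.Im R \o f).

(* derivative of u at p along the a-th coordinate vector field of the chart i *)
Definition partial (i : I) (a : 'I_n.+1) (u : M -> R) (p : M) : R :=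
  pderiv a (u \o param i) (coord i p).

Definition jac (i j : I) (p : M) : 'M[R]_n.+1 :=
  \matrix_(a, b) partial i a (fun q => coord j q ord0 b) p.

(* A covariant tensor field is given by its components at p in each chart i;
   they are meaningful only if p belongs to [dom i]. *)
Definition covector_field := I -> M -> 'rV[R]_n.+1.
Definition ccovector_field := I -> M -> 'rV[R[i]]_n.+1.
Definition bilinear_field := I -> M -> 'M[R]_n.+1.

Definition one_form (w : covector_field) :=
  (forall i b, smooth_on (coord i @` dom i) (fun x => w i (param i x) ord0 b)) /\
  (forall i j p, dom i p -> dom j p -> w i p = w j p *m (jac i j p)^T).

Definition riemannian_metric (g : bilinear_field) :=
  [/\ forall i a b,
        smooth_on (coord i @` dom i) (fun x => g i (param i x) a b),
      forall i j p, dom i p -> dom j p ->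
        g i p = jac i j p *m g j p *m (jac i j p)^T,
      forall i p, dom i p -> (g i p)^T = g i p
    & forall i p (v : 'rV[R]_n.+1), dom i p -> v != 0 ->
        0 < (v *m g i p *m v^T) ord0 ord0].

Definition diff_form (u : M -> R) : covector_field :=
  fun i p => \row_a partial i a u p.

Definition cdiff_form (f : M -> R[i]) : ccovector_field :=
  fun i p => \row_a
    (partial i a (@complex.Re R \o f) p +i* partial i a (@complex.Im R \o f) p).

(* components of the vector field dual to w *)
Definition sharp (g : bilinear_field) (w : covector_field) : covector_field :=
  fun i p => w i p *m invmx (g i p).

(* pointwise inner product of 1-forms induced by g *)
Definition form_inner (g : bilinear_field) (v w : covector_field) (p : M) : R :=
  let i := chart_at A p in (v i p *m (sharp g w i p)^T) ord0 ord0.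

(* contraction of the complex 1-form w with the vector field dual to eta *)
Definition contraction (g : bilinear_field) (eta : covector_field)
    (w : ccovector_field) (p : M) : R[i] :=
  let i := chart_at A p in
  \sum_a (sharp g eta i p ord0 a)%:C * w i p ord0 a.

Definition test_function (phi : M -> R) :=
  smooth_fun phi /\ exists K : set M,
    [/\ compact K, K `<=` ~` boundary & forall p, ~ K p -> phi p = 0].

Definition magnetic_differential (eta : covector_field) (f : M -> R[i]) :
    ccovector_field :=
  fun i p => cdiff_form f i p + ('i%C * f p) *: map_mx (real_complex R) (eta i p).

(* complex-linear extension of an operator on real 1-forms *)
Definition complexified (delta : covector_field -> M -> R)
    (w : ccovector_field) (p : M) : R[i] :=
  delta (fun i q => map_mx (@complex.Re R) (w i q)) p
    +i* delta (fun i q => map_mx (@complex.Im R) (w i q)) p.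

Definition magnetic_codifferential (g : bilinear_field)
    (delta : covector_field -> M -> R) (eta : covector_field)
    (w : ccovector_field) (p : M) : R[i] :=
  complexified delta w p - 'i%C * contraction g eta w p.

Definition magnetic_laplacian (g : bilinear_field)
    (delta : covector_field -> M -> R) (eta : covector_field)
    (f : M -> R[i]) : M -> R[i] :=
  magnetic_codifferential g delta eta (magnetic_differential eta f).

End Manifold.

Definition borel (M : ptopologicalType) := g_sigma_algebraType (@open M).

Section Integration.
Context {R : realType} {n : nat} {M : ptopologicalType} (A : atlas R n M).

(* The Borel measure of the Riemannian metric g is determined by the integrals
   of continuous functions supported in a chart domain. *)
Definition riemannian_volume (g : bilinear_field A)
    (vol : {measure set (borel M) -> \bar R}) :=
  forall (i : chart A) (psi : M -> R) (K : set M),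
    continuous psi -> compact K -> K `<=` dom i ->
    (forall p, ~ K p -> psi p = 0) ->
    \int[vol]_p psi p =
    iter_integral (patch (fun=> 0) (coord i @` dom i)
      (fun x => psi (param i x) * Num.sqrt (\det (g i (param i x))))).

(* delta is the formal adjoint of the exterior differential on functions *)
Definition codifferential (g : bilinear_field A)
    (vol : {measure set (borel M) -> \bar R})
    (delta : covector_field A -> M -> R) :=
  forall w, one_form w ->
    smooth_fun A (delta w) /\
    forall phi, test_function A phi ->
      \int[vol]_p form_inner g (diff_form phi) w p =
      \int[vol]_p (phi p * delta w p).

End Integration.

(* Main.v *)
Require Import Defs.
From mathcomp Require Import all_boot all_order all_algebra.
From mathcomp Require Import all_classical all_reals all_analysis.
From mathcomp Require Import complex.
From mathcomp Require Import measurable_realfun ring lra.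

(* Write f = a + i b and d^eta f = alpha + i beta, so that alpha = da - b eta and
   beta = db + a eta.  The equation says delta alpha = - <eta, beta> and
   delta beta = <eta, alpha>.  Let u = |f|^2 and suppose that u < c on the boundary
   for some c below the maximum m of u.  Put phi = psi (u - c), where
   psi t = exp (-1/t) for t > 0 and psi t = 0 otherwise; phi is supported in the
   interior.  Testing the two equations with a phi and b phi and adding gives
     int (psi' (u - c) |du|^2 / 2 + phi (|alpha|^2 + |beta|^2)) = 0,
   so du = 0 where u > c.  Hence {u = m} is open and closed, thus all of M, which
   contradicts u < c on the nonempty boundary.
   Integrals over M are related to pointwise information by the functions that in
   a chart are a product of one-variable hats divided by sqrt (det g): their
   integral is an explicit positive number, which yields both the finiteness of
   the volume of compact subsets of the interior and its positivity on open ones. *)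

Set Implicit Arguments.
Unset Strict Implicit.
Unset Printing Implicit Defensive.

Import Order.TTheory GRing.Theory Num.Theory.
Import numFieldNormedType.Exports.

Local Open Scope classical_set_scope.
Local Open Scope ring_scope.
Local Open Scope complex_scope.

(* The library also has [vector.coord]. *)
Local Notation coord := Defs.coord.

(** * Smooth functions on open sets *)

(** The first-order expansion of [F] at [x] is also one of [G], and uniqueness of the differential
    turns such an expansion into differentiability. *)
Lemma near_eq_differentiable (R : realType) (V W : normedModType R)
    (F G : V -> W) (x : V) :
  (\forall y \near x, F y = G y) -> differentiable F x -> differentiable G x.
Proof.
move=> FG dF; have Fx := nbhs_singleton FG.
have key : G \o shift x = cst (G x) + 'd F x +o_ 0 id.
  have FG0 : \forall h \near (0 : V), F (h + x) = G (h + x).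
    by move: FG; rewrite (near_shift 0 x) /= subr0.
  apply/eqaddoP => /= e e0.
  move: (diff_locally dF) => /eqaddoP /(_ e e0); apply: filterS2 FG0 => h.
  by rewrite /= !fctE /= Fx => ->.
have dFc : continuous ('d F x) by exact: diff_continuous.
by apply/diff_locallyP; rewrite (diff_unique dFc key).
Qed.

Section SmoothOpen.
Context {R : realType} {n : nat}.
Local Notation E := 'rV[R]_n.+1.
Implicit Types (W : set E) (F G : E -> R).

(** A bound on the order allows induction for products and compositions. The recursion peels off the
    innermost derivative, which is the last entry of the sequence in [iter_partial]. *)
Fixpoint differentiable_upto (k : nat) W F : Prop :=
  (forall x, W x -> differentiable F x) /\
  match k with
  | 0 => True
  | k'.+1 => forall a, differentiable_upto k' W ('D_(basis_vec a) F)
  end.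

Lemma differentiable_uptoP k W F : differentiable_upto k W F <->
  forall s x, (size s <= k)%N -> W x -> differentiable (iter_partial s F) x.
Proof.
elim: k F => [|k IH] F /=.
  by split => [[h _] [|//] x _|h]; [exact: h|split => // x; exact: (h [::])].
split => [[h0 h1] s|h].
  case/lastP: s => [x _|s a x]; first exact: h0.
  rewrite size_rcons ltnS /iter_partial foldr_rcons => sk.
  exact: ((IH _).1 (h1 a)).
split => [x|a]; first exact: (h [::]).
apply/IH => s x sk Wx.
by have := h (rcons s a) x; rewrite size_rcons /iter_partial foldr_rcons; apply.
Qed.

Lemma smooth_openP W F : smooth_open W F <-> forall k, differentiable_upto k W F.
Proof.
split => [h k|h s x Wx]; first by apply/differentiable_uptoP => s x _; exact: h.
by move/differentiable_uptoP: (h (size s)); exact.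
Qed.

Lemma differentiable_upto_eq k W F G : open W -> (forall x, W x -> F x = G x) ->
  differentiable_upto k W F -> differentiable_upto k W G.
Proof.
move=> oW; elim: k F G => [|k IH] F G FG /= [dF kF].
  split=> // x Wx; apply: near_eq_differentiable (dF _ Wx).
  by apply: filterS (open_nbhs_nbhs (conj oW Wx)).
have nFG x : W x -> \forall y \near x, F y = G y.
  by move=> Wx; apply: filterS (open_nbhs_nbhs (conj oW Wx)).
split=> [x Wx|a]; first exact: near_eq_differentiable (nFG _ Wx) (dF _ Wx).
by apply: IH (kF a) => x Wx; apply: near_eq_derive; exact: nFG.
Qed.

Lemma differentiable_uptoW k W F :
  differentiable_upto k.+1 W F -> differentiable_upto k W F.
Proof.
move/differentiable_uptoP => h; apply/differentiable_uptoP => s x sk.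
by apply: h; exact: leqW.
Qed.

Lemma differentiable_uptoD k W F G : open W -> differentiable_upto k W F ->
  differentiable_upto k W G -> differentiable_upto k W (F + G).
Proof.
move=> oW; elim: k F G => [|k IH] F G /= [dF kF] [dG kG].
  by split=> // x Wx; apply: differentiableD; [exact: dF|exact: dG].
split=> [x Wx|a]; first by apply: differentiableD; [exact: dF|exact: dG].
apply: differentiable_upto_eq (IH _ _ (kF a) (kG a)) => // x Wx.
by rewrite [in RHS]deriveD //; apply: diff_derivable; [exact: dF|exact: dG].
Qed.

Lemma differentiable_uptoM k W F G : open W -> differentiable_upto k W F ->
  differentiable_upto k W G -> differentiable_upto k W (F * G).
Proof.
move=> oW; elim: k F G => [|k IH] F G.
  move=> /= [dF kF] [dG kG].
  by split=> // x Wx; apply: differentiableM; [exact: dF|exact: dG].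
move=> kF kG; have /= [dF kF'] := kF; have /= [dG kG'] := kG.
split=> [x Wx|a]; first by apply: differentiableM; [exact: dF|exact: dG].
apply: (@differentiable_upto_eq _ _
  (F * 'D_(basis_vec a) G + G * 'D_(basis_vec a) F)) => //.
  move=> x Wx; rewrite [in RHS]deriveM //; apply: diff_derivable.
    exact: dF.
  exact: dG.
by apply: differentiable_uptoD => //; apply: IH => //;
  exact: differentiable_uptoW.
Qed.

Lemma differentiable_upto_cst k W (c : R) :
  open W -> differentiable_upto k W (cst c).
Proof.
move=> oW; elim: k c => [|k IH] c /=.
  by split=> // x _; exact: differentiable_cst.
split=> [x _|a]; first exact: differentiable_cst.
by apply: differentiable_upto_eq (IH 0) => // x _; rewrite derive_cst.
Qed.

(* A smooth function of one variable is given with all its derivatives [h k]. *)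
Lemma differentiable_upto_comp (k j : nat) W F (h : nat -> R -> R) : open W ->
  (forall k (t : R), is_derive t 1 (h k) (h k.+1 t)) ->
  differentiable_upto k W F -> differentiable_upto k W (h j \o F).
Proof.
move=> oW dh; have dfh i t : differentiable (h i) t.
  by apply/derivable1_diffP; have [] := dh i t.
(* Differentiating [h j \o F] produces [h j.+1], so [j] stays general in the induction. *)
elim: k j F => [|k IH] j F.
  move=> /= [dF _]; split=> // x Wx.
  exact: differentiable_comp (dF _ Wx) (dfh _ _).
move=> kF; have /= [dF kF'] := kF.
split=> [x Wx|a]; first exact: differentiable_comp (dF _ Wx) (dfh _ _).
apply: (@differentiable_upto_eq _ _ ((h j.+1 \o F) * 'D_(basis_vec a) F)) => //.
  move=> x Wx.
  have dFx := dF _ Wx; have dhF := differentiable_comp dFx (dfh j (F x)).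
  rewrite [RHS](deriveE _ dhF) diff_comp //=.
  have [_ dv] := dh j (F x).
  by rewrite diff1E // derive1E dv -(deriveE _ dFx); exact: mulrC.
by apply: differentiable_uptoM => //; apply: IH => //;
  exact: differentiable_uptoW.
Qed.

End SmoothOpen.

(** * Calculus on the half-space *)

Section HalfSpaceDerivatives.
Context {R : realType} {n : nat}.
Local Notation E := 'rV[R]_n.+1.
Implicit Types (A W : set E) (F G : E -> R).

Definition rel_open A := exists2 W, open W & A = W `&` halfspace.

Lemma increment_cvg (x v : E) : (x + h *: v) @[h --> (0:R)] --> x.
Proof.
rewrite -[X in _ --> X]addr0 -(scale0r v).
by apply: cvgD; [exact: cvg_cst|apply: cvgZr_tmp; exact: cvg_id].
Qed.

(** Positive multiples of a basis vector never lead out of the half-space, so small positive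
    increments are always admissible. Properness makes the limit in [pderiv] unique. *)
Lemma within_halfspace_proper (a : 'I_n.+1) (x : E) : halfspace x ->
  ProperFilter (within [set h : R | halfspace (x + h *: basis_vec a)] 0^').
Proof.
move=> hx; apply: Build_ProperFilter_ex => P [/= e /= e0 he].
exists (e / 2); apply: he => /=.
- by rewrite sub0r normrN gtr0_norm ?divr_gt0 // ltr_pdivrMr // ltr_pMr // ltr1n.
- by rewrite lt0r_neq0 // divr_gt0.
- rewrite /halfspace /= !mxE addr_ge0 // mulr_ge0 ?ler0n //.
  by rewrite divr_ge0 // ltW.
Qed.

(** Along admissible increments the difference quotients of [F] and [G] coincide, and restricting
    the increments preserves the limit of those of [G]. This reduces [pderiv] to ordinary
    derivatives of extensions. *)
Lemma pderiv_near (a : 'I_n.+1) F G (x : E) :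
  halfspace x -> differentiable G x ->
  (\forall y \near x, halfspace y -> F y = G y) ->
  pderiv a F x = 'D_(basis_vec a) G x.
Proof.
move=> hx dG FG; rewrite /pderiv.
have PF := within_halfspace_proper a hx.
apply: cvg_lim => //.
have /cvg_ex [l Hl] : derivable G x (basis_vec a) by exact: diff_derivable.
rewrite /derive (cvg_lim _ Hl) //.
set D := [set h : R | _].
have Hl' := @cvg_within_filter _ _ _ _ _ _ D Hl.
apply: cvg_trans (Hl' _).
apply: near_eq_cvg.
have xh : \forall h \near (0 : R), halfspace (x + h *: basis_vec a) ->
    F (x + h *: basis_vec a) = G (x + h *: basis_vec a).
  exact: (increment_cvg (basis_vec a) FG).
rewrite /dnbhs !near_withinE; apply: filterS xh => h Hh h0 hh /=.
by rewrite (addrC _ x) Hh // (nbhs_singleton FG).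
Qed.

(** Intersecting [W] with the open set that cuts [A] out of the half-space puts every half-space
    point of the new neighbourhood into [A]. *)
Lemma smooth_on_ext A F x : rel_open A -> smooth_on A F -> A x ->
  exists W G, [/\ open W, W x, smooth_open W G &
    forall y, halfspace y -> W y -> A y /\ F y = G y].
Proof.
move=> [W0 oW0 AE] sF Ax; have [W [G [oW Wx sG FG]]] := sF _ Ax.
exists (W `&` W0), G; split.
- exact: openI.
- by split => //; move: Ax; rewrite AE => -[].
- by move=> s y [Wy _]; exact: sG.
- move=> y hy [Wy W0y]; have Ay : A y by rewrite AE.
  by split => //; exact: FG.
Qed.

Lemma rel_open_half A x : rel_open A -> A x -> halfspace x.
Proof. by move=> [W _ ->] []. Qed.

Lemma smooth_open_deriv W G a : smooth_open W G -> smooth_open W ('D_(basis_vec a) G).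
Proof.
move=> sG s x Wx; have := sG (rcons s a) x Wx.
by rewrite /iter_partial foldr_rcons.
Qed.

Lemma smooth_openM W F G : open W ->
  smooth_open W F -> smooth_open W G -> smooth_open W (F * G).
Proof.
move=> oW /smooth_openP sF /smooth_openP sG; apply/smooth_openP => k.
exact: differentiable_uptoM.
Qed.

Lemma smooth_openD W F G : open W ->
  smooth_open W F -> smooth_open W G -> smooth_open W (F + G).
Proof.
move=> oW /smooth_openP sF /smooth_openP sG; apply/smooth_openP => k.
exact: differentiable_uptoD.
Qed.

Lemma smooth_open_comp W F (h : nat -> R -> R) (j : nat) : open W ->
  (forall k (t : R), is_derive t 1 (h k) (h k.+1 t)) ->
  smooth_open W F -> smooth_open W (h j \o F).
Proof.
move=> oW dh /smooth_openP sF; apply/smooth_openP => k.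
exact: differentiable_upto_comp.
Qed.

Lemma smooth_on_eq A F G : (forall x, A x -> F x = G x) ->
  smooth_on A F -> smooth_on A G.
Proof.
move=> FG sF x Ax; have [W [H [oW Wx sH FH]]] := sF _ Ax.
by exists W, H; split => // y Ay Wy; rewrite -FG // FH.
Qed.

Lemma smooth_on_cst A (c : R) : smooth_on A (fun=> c).
Proof.
move=> x _; exists setT, (cst c); split => //; first exact: openT.
by apply/smooth_openP => k; apply: differentiable_upto_cst; exact: openT.
Qed.

Lemma smooth_onD A F G : smooth_on A F -> smooth_on A G ->
  smooth_on A (fun x => F x + G x).
Proof.
move=> sF sG x Ax; have [W [H [oW Wx sH FH]]] := sF _ Ax.
have [W' [H' [oW' Wx' sH' FH']]] := sG _ Ax.
exists (W `&` W'), (H + H'); split => //; first exact: openI.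
  apply: smooth_openD; first exact: openI.
    by move=> s y [Wy _]; exact: sH.
  by move=> s y [_ Wy]; exact: sH'.
by move=> y Ay [Wy Wy']; rewrite FH // FH'.
Qed.

Lemma smooth_onM A F G : smooth_on A F -> smooth_on A G ->
  smooth_on A (fun x => F x * G x).
Proof.
move=> sF sG x Ax; have [W [H [oW Wx sH FH]]] := sF _ Ax.
have [W' [H' [oW' Wx' sH' FH']]] := sG _ Ax.
exists (W `&` W'), (H * H'); split => //; first exact: openI.
  apply: smooth_openM; first exact: openI.
    by move=> s y [Wy _]; exact: sH.
  by move=> s y [_ Wy]; exact: sH'.
by move=> y Ay [Wy Wy']; rewrite FH // FH'.
Qed.

Lemma smooth_on_comp A F (h : nat -> R -> R) (j : nat) :
  (forall k (t : R), is_derive t 1 (h k) (h k.+1 t)) ->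
  smooth_on A F -> smooth_on A (fun x => h j (F x)).
Proof.
move=> dh sF x Ax; have [W [H [oW Wx sH FH]]] := sF _ Ax.
exists W, (h j \o H); split => //; first exact: smooth_open_comp.
by move=> y Ay Wy; rewrite FH.
Qed.

Lemma smooth_on_pderiv A F a : rel_open A -> smooth_on A F ->
  smooth_on A (pderiv a F).
Proof.
move=> oA sF x Ax; have [W [G [oW Wx sG FG]]] := smooth_on_ext oA sF Ax.
exists W, ('D_(basis_vec a) G); split => //; first exact: smooth_open_deriv.
move=> y Ay Wy; apply: pderiv_near; first exact: rel_open_half Ay.
  exact: (sG [::]).
apply: filterS (open_nbhs_nbhs (conj oW Wy)) => z Wz hz.
by have [] := FG z hz Wz.
Qed.

Lemma smooth_on_cvg A F x : smooth_on A F -> A x ->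
  F @ within A (nbhs x) --> F x.
Proof.
move=> sF Ax; have [W [G [oW Wx sG FG]]] := sF _ Ax.
rewrite (FG x) //; apply: (@cvg_trans _ (G @ within A (nbhs x))).
  apply: near_eq_cvg; rewrite near_withinE.
  by apply: filterS (open_nbhs_nbhs (conj oW Wx)) => z Wz Az; rewrite FG.
apply: cvg_within_filter; apply: differentiable_continuous.
exact: (sG [::]).
Qed.

Lemma smooth_on_near A F x : rel_open A -> smooth_on A F -> A x ->
  exists2 G, differentiable G x &
    \forall y \near x, halfspace y -> A y /\ F y = G y.
Proof.
move=> oA sF Ax; have [W [G [oW Wx sG FG]]] := smooth_on_ext oA sF Ax.
exists G; first exact: (sG [::]).
by apply: filterS (open_nbhs_nbhs (conj oW Wx)) => z Wz hz; exact: FG.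
Qed.

Lemma pderivD A F G a x : rel_open A -> smooth_on A F -> smooth_on A G -> A x ->
  pderiv a (fun y => F y + G y) x = pderiv a F x + pderiv a G x.
Proof.
move=> oA sF sG Ax; have hx := rel_open_half oA Ax.
have [F' dF FF] := smooth_on_near oA sF Ax.
have [G' dG GG] := smooth_on_near oA sG Ax.
rewrite (@pderiv_near a F _ x hx dF); last by apply: filterS FF => y h /h[].
rewrite (@pderiv_near a G _ x hx dG); last by apply: filterS GG => y h /h[].
rewrite (@pderiv_near _ _ (F' + G')) //.
- by rewrite deriveD //; exact: diff_derivable.
- exact: differentiableD.
- by apply: filterS2 FF GG => y h h' hy; rewrite (h _).2 // (h' _).2.
Qed.

Lemma pderivM A F G a x : rel_open A -> smooth_on A F -> smooth_on A G -> A x ->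
  pderiv a (fun y => F y * G y) x = F x * pderiv a G x + G x * pderiv a F x.
Proof.
move=> oA sF sG Ax; have hx := rel_open_half oA Ax.
have [F' dF FF] := smooth_on_near oA sF Ax.
have [G' dG GG] := smooth_on_near oA sG Ax.
rewrite (@pderiv_near a F _ x hx dF); last by apply: filterS FF => y h /h[].
rewrite (@pderiv_near a G _ x hx dG); last by apply: filterS GG => y h /h[].
rewrite (nbhs_singleton FF hx).2 (nbhs_singleton GG hx).2.
rewrite (@pderiv_near _ _ (F' * G')) //.
- by rewrite deriveM //; exact: diff_derivable.
- exact: differentiableM.
- by apply: filterS2 FF GG => y h h' hy; rewrite (h _).2 // (h' _).2.
Qed.

Lemma derive_comp1 F (h : R -> R) (dh : R) (x v : E) : differentiable F x ->
  is_derive (F x) 1 h dh -> 'D_v (h \o F) x = dh * 'D_v F x.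
Proof.
move=> dF [dvh <-].
have dfh : differentiable h (F x) by exact/derivable1_diffP.
rewrite (deriveE _ (differentiable_comp dF dfh)) diff_comp //=.
by rewrite diff1E // derive1E -(deriveE _ dF); exact: mulrC.
Qed.

Lemma pderiv_comp A F (h : R -> R) dh a x : rel_open A -> smooth_on A F -> A x ->
  is_derive (F x) 1 h dh ->
  pderiv a (fun y => h (F y)) x = dh * pderiv a F x.
Proof.
move=> oA sF Ax dhx; have hx := rel_open_half oA Ax.
have [F' dF FF] := smooth_on_near oA sF Ax.
have FxE := (nbhs_singleton FF hx).2; rewrite FxE in dhx.
rewrite (@pderiv_near a F _ x hx dF); last by apply: filterS FF => y h' /h'[].
rewrite -(derive_comp1 _ dF dhx); apply: pderiv_near => //.
  by apply: differentiable_comp => //; apply/derivable1_diffP; case: dhx.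
by apply: filterS FF => y h' hy; rewrite (h' _).2.
Qed.

(** The components of [T] are extended to functions [S b] differentiable at [x] and assembled into
    [U], and [F'] is extended to [G]. Inside the half-space [F] agrees with [G \o U] near [x], so
    the ordinary chain rule applies. *)
Lemma pderiv_chain A B (T : E -> E) F F' a x :
  rel_open A -> rel_open B -> A x ->
  (forall b, smooth_on A (fun y => T y ord0 b)) -> smooth_on B F' ->
  (forall y, A y -> B (T y) /\ F y = F' (T y)) ->
  pderiv a F x =
  \sum_b pderiv a (fun y => T y ord0 b) x * pderiv b F' (T x).
Proof.
move=> oA oB Ax sT sF' H; have hx := rel_open_half oA Ax.
have [BTx _] := H _ Ax; have hTx := rel_open_half oB BTx.
have [G dG GG] := smooth_on_near oB sF' BTx.
have /choice [S HS] : forall b, exists S : E -> R, differentiable S x /\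
    \forall y \near x, halfspace y -> A y /\ T y ord0 b = S y.
  by move=> b; have [S] := smooth_on_near oA (sT b) Ax; exists S.
pose U y : E := \row_b S b y.
have UE : U = \sum_b (fun y => S b y *: (basis_vec b : E)).
  apply/funext => y; rewrite fct_sumE; apply/rowP => b.
  rewrite !mxE summxE (bigD1 b) //= !mxE !eqxx mulr1 big1 ?addr0 // => c cb.
  by rewrite !mxE eqxx eq_sym (negbTE cb) mulr0.
have dU : differentiable U x.
  rewrite UE; apply: differentiable_sum => b.
  by apply: differentiableZl; exact: (HS b).1.
have TU : \forall y \near x, halfspace y -> A y /\ T y = U y.
  have : \forall y \near x, forall b, halfspace y -> A y /\ T y ord0 b = S b y.
    exact: (@filter_forall _ _
      (fun b y => halfspace y -> A y /\ T y ord0 b = S b y) _ _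
      (fun b => (HS b).2)).
  apply: filterS => y h hy; split; first by have [] := h ord0 hy.
  by apply/rowP => b; rewrite mxE (h b hy).2.
have TUx : T x = U x by have [] := nbhs_singleton TU hx.
rewrite TUx in GG hTx dG *.
rewrite (@pderiv_near _ _ (G \o U)) //; last first.
- have UG := differentiable_continuous dU GG.
  apply: filterS2 TU UG => y h1 h2 hy.
  have [Ay TyE] := h1 hy; have [BTy ->] := H _ Ay.
  by rewrite TyE /= (h2 _).2 // -TyE; exact: rel_open_half BTy.
- exact: differentiable_comp.
rewrite (deriveE _ (differentiable_comp dU dG)) diff_comp //=.
rewrite -(deriveE _ dU) derive_mx; last exact: diff_derivable.
set r := (X in 'd G _ X).
have -> : r = \sum_b r ord0 b *: (basis_vec b : E) by rewrite [LHS]row_sum_delta.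
rewrite linear_sum; apply: eq_bigr => b _; rewrite linearZ /=.
rewrite (@pderiv_near b F' _ _ hTx dG); last by apply: filterS GG => y h /h[].
rewrite (pderiv_near a hx (HS b).1); last by apply: filterS (HS b).2 => y h /h[].
rewrite -(deriveE _ dG) /r mxE; congr (_ * _).
by congr (derive _ _ _); apply/funext => y; rewrite mxE.
Qed.

Lemma is_derive_line (x v : E) (t : R) : is_derive t 1 (fun s => x + s *: v) v.
Proof.
have H : (fun h : R => h^-1 *: (((fun s => x + s *: v) \o shift t) (h *: 1) -
    (x + t *: v))) @ 0^' --> v.
  apply: cvg_near_cst; apply: filterS (nbhs_dnbhs_neq 0) => h h0 /=.
  rewrite scalerDl opprD addrACA subrr add0r addrK scalerA [_ *: 1]mulr1.
  by rewrite mulVf // scale1r.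
by apply: DeriveDef; [apply/cvg_ex; exists v|exact: cvg_lim H].
Qed.

(** The segment from [x] to [y] stays in the ball, and the mean value theorem applies to [F] along
    it. *)
Lemma zero_derivative_cst F (x : E) (r : R) :
  (forall y, ball x r y -> differentiable F y) ->
  (forall y a, ball x r y -> 'D_(basis_vec a) F y = 0) ->
  forall y, ball x r y -> F y = F x.
Proof.
move=> dF zF y bxy.
pose l (t : R) : E := x + t *: (y - x).
have bl t : 0 <= t <= 1 -> ball x r (l t).
  move=> /andP[t0 t1]; rewrite -ball_normE /ball_ /= /l opprD addrA subrr add0r.
  rewrite normrN normrZ ger0_norm //.
  move: bxy; rewrite -ball_normE /ball_ /= distrC; apply: le_lt_trans.
  by rewrite ler_piMl.
have dl (t : R) : is_derive t 1 l (y - x) by exact: is_derive_line.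
have dFl (t : R) : 0 <= t <= 1 -> is_derive t 1 (F \o l) 0.
  move=> t01; have dlt : differentiable l t by apply/derivable1_diffP; case: (dl t).
  have dFlt := dF _ (bl _ t01).
  apply: DeriveDef.
    by apply/derivable1_diffP; exact: differentiable_comp.
  rewrite (deriveE _ (differentiable_comp dlt dFlt)) diff_comp //=.
  rewrite (row_sum_delta ('d l t 1)) linear_sum big1 // => b _.
  by rewrite linearZ /= -(deriveE _ dFlt) zF ?scaler0 //; exact: bl.
have [|||c c01] := @MVT_segment _ (F \o l) (cst 0) 0 1.
- by [].
- by move=> t; rewrite in_itv /= => /andP[t0 t1]; apply: dFl; rewrite !ltW.
- apply: continuous_in_subspaceT => t; rewrite inE /= in_itv /= => t01.
  apply: differentiable_continuous; apply/derivable1_diffP.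
  by case: (dFl t t01).
- rewrite /= /l mul0r scale0r addr0 scale1r [x + _]addrC subrK => /eqP.
  by rewrite subr_eq0 => /eqP.
Qed.

(** Along the line through [x] in direction [v], [F] has a local minimum at the parameter 0. *)
Lemma derive_at_min F (x v : E) :
  (\forall y \near x, differentiable F y /\ F x <= F y) -> 'D_v F x = 0.
Proof.
move=> minF; pose l (t : R) : E := x + t *: v.
have dl (t : R) : is_derive t 1 l v by exact: is_derive_line.
have dfl (t : R) : differentiable l t by apply/derivable1_diffP; case: (dl t).
have l0 : l 0 = x by rewrite /l scale0r addr0.
have [e /= e0 He] := increment_cvg v minF.
have Hl t : t \in `]- e, e[ -> differentiable F (l t) /\ F x <= F (l t).
  rewrite in_itv /= => te; apply: He.
  by rewrite /= sub0r normrN ltr_norml.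
have dFl t : t \in `]- e, e[ -> derivable (F \o l) t 1.
  move=> /Hl[dF _]; apply/derivable1_diffP; exact: differentiable_comp.
have e00 : 0 \in `]- e, e[ by rewrite in_itv /= oppr_lt0 e0.
have ee : - e <= e by rewrite (le_trans _ (ltW e0)) // oppr_le0 ltW.
have [|_] := derive1_at_min ee dFl e00.
  by move=> t /Hl[_]; rewrite /= l0.
have dF : differentiable F (l 0) by have [] := Hl _ e00.
rewrite (deriveE _ (differentiable_comp (dfl 0) dF)) diff_comp //=.
rewrite -(deriveE _ (dfl 0)) l0 in dF *.
by rewrite -deriveE //; have [_ ->] := dl 0.
Qed.

End HalfSpaceDerivatives.

(** * Flat functions and matrices *)

Section FlatFunctions.
Context {R : realType}.
Implicit Types (p : {poly R}) (t : R).

(** This family contains [exp (-1/t)] extended by 0 and is closed under differentiation, so it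
    contains all the derivatives of that function. *)
Definition flat p t : R := if 0 < t then p.[t^-1] * expR (- t^-1) else 0.

(** With [s = 1/t], the derivative of [p(s) exp (-s)] in [s] is [(p' - p)(s) exp (-s)], and
    [ds/dt = - s^2]. *)
Definition flat_deriv p : {poly R} := 'X^2 * (p - p^`()).

(** For [s >= 0] the monomial [s ^+ i] is at most [i! * expR s], being a term of the exponential
    series up to the factorial. *)
Lemma horner_expRN_bounded p :
  exists C, forall s : R, 0 <= s -> `|p.[s]| * expR (- s) <= C.
Proof.
exists (\sum_(i < size p) `|p`_i| * i`!%:R) => s s0.
have ps : `|p.[s]| <= \sum_(i < size p) `|p`_i| * s ^+ i.
  rewrite horner_coef; apply: le_trans (ler_norm_sum _ _ _) _.
  by apply: ler_sum => i _; rewrite normrM normrX (ger0_norm s0).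
apply: le_trans (ler_wpM2r (expR_ge0 _) ps) _.
rewrite mulr_suml; apply: ler_sum => i _; rewrite -mulrA ler_wpM2l //.
rewrite expRN ler_pdivrMr ?expR_gt0 //.
case: (nat_of_ord i) => [|k].
  by rewrite expr0 fact0 mul1r (le_trans _ (expR_ge1Dx _)) // lerDl.
rewrite mulrC -ler_pdivrMr ?ltr0n ?fact_gt0 //.
by apply: le_trans (expR_ge1Dxn k s0); rewrite lerDr.
Qed.

(** Bounding [p * 'X^2] instead of [p] gains the factor [t ^+ 2]. The maximum with 1 only makes the
    constant positive. *)
Lemma flat_bounded p : exists2 C, 0 < C & forall t, `|flat p t| <= C * t ^+ 2.
Proof.
have [C HC] := horner_expRN_bounded (p * 'X^2).
exists (Num.max C 1) => [|t]; first by rewrite lt_max ltr01 orbT.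
rewrite /flat; case: ifPn => [t0|_]; last first.
  by rewrite normr0 mulr_ge0 ?sqr_ge0 // le_max ler01 orbT.
rewrite -ler_pdivrMr ?exprn_gt0 // le_max; apply/orP; left.
have := HC t^-1; rewrite invr_ge0 ltW // => /(_ isT); apply: le_trans.
rewrite hornerM hornerXn [`|_ * _ ^+ _|]normrM [`|_ * expR _|]normrM.
rewrite (ger0_norm (expR_ge0 _)).
by rewrite (ger0_norm (exprn_ge0 _ _)) ?invr_ge0 ?(ltW t0) // exprVn mulrAC.
Qed.

Lemma is_derive_flat p t : is_derive t 1 (flat p) (flat (flat_deriv p) t).
Proof.
have [t0|t0|t0] := ltgtP t 0.
- have -> : flat (flat_deriv p) t = 0 by rewrite /flat ltNge ltW.
  apply: (near_eq_is_derive _ (is_derive_cst (0 : R) t 1)).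
  near=> s; rewrite /flat ltNge ifF //; apply/negbF/ltW.
  by near: s; exact: lt_nbhsl.
- have tn0 : t != 0 by rewrite gt_eqF.
  have d1 : is_derive t 1 (fun s : R => s^-1) (- t ^- 2).
    have := @is_deriveV _ id t 1 1 tn0 (is_derive_id _ _).
    by rewrite [_ *: 1]mulr1.
  have d2 : is_derive t 1 (fun s => p.[s^-1]) (- t ^- 2 * p^`().[t^-1]).
    rewrite mulrC; exact: (is_derive1_comp (f := horner p)).
  have d3 : is_derive t 1 (fun s => expR (- s^-1)) (expR (- t^-1) * t ^- 2).
    apply: (is_derive1_comp (f := expR)).
    by rewrite -[t ^- 2]opprK; exact: is_deriveN.
  apply: near_eq_is_derive; last first.
    apply: is_derive_eq (is_deriveM d2 d3) _.
    rewrite /flat t0 /flat_deriv hornerM hornerXn hornerD hornerN.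
    by rewrite /GRing.scale /= exprVn; ring.
  near=> s; rewrite /flat ifT //.
  by near: s; exact: lt_nbhsr.
(* At 0 the quadratic bound makes the difference quotient at most [C * |h|]. *)
- subst t; have [C C0 HC] := flat_bounded p.
  have f0 q : flat q 0 = 0 by rewrite /flat ltxx.
  rewrite f0.
  have H : (fun h : R => h^-1 *: ((flat p \o shift 0) (h *: 1) - flat p 0)) @ 0^' --> 0.
    apply/cvgr0Pnorm_le => e e0; near=> h.
    have h0 : h != 0 by near: h; exact: nbhs_dnbhs_neq.
    rewrite /= addr0 f0 subr0 [h *: 1]mulr1 normrZ normfV.
    rewrite mulrC ler_pdivrMr ?normr_gt0 //.
    apply: le_trans (HC h) _; rewrite -[h ^+ 2]real_normK ?num_real // expr2 mulrA.
    rewrite ler_pM2r ?normr_gt0 // mulrC -ler_pdivlMr //.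
    by near: h; apply: dnbhs0_le; rewrite divr_gt0.
  by apply: DeriveDef; [apply/cvg_ex; exists 0|exact: cvg_lim H].
Unshelve. all: by end_near. Qed.

Lemma flat_gt0 p t : 0 < t -> 0 < p.[t^-1] -> 0 < flat p t.
Proof. by move=> t0 pt; rewrite /flat t0 mulr_gt0 // expR_gt0. Qed.

(* The derivatives of [exp (-1/t)], extended by 0 to the half-line [t <= 0]. *)
Definition flat_exp (k : nat) : R -> R := flat (iter k flat_deriv 1).

Lemma is_derive_flat_exp k t : is_derive t 1 (flat_exp k) (flat_exp k.+1 t).
Proof. exact: is_derive_flat. Qed.

End FlatFunctions.

(** * Continuity of determinants and inverses; positive definite matrices *)

Section MatrixLemmas.
Context {R : realType}.

Lemma cvg_det (T : Type) (F : set_system T) (n : nat) (A : T -> 'M[R]_n)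
    (B : 'M[R]_n) : Filter F ->
  (forall i j, A t i j @[t --> F] --> B i j) -> \det (A t) @[t --> F] --> \det B.
Proof.
move=> FF AB; rewrite /determinant.
apply: cvg_big => [|s _]; first by move=> x; exact: add_continuous.
apply: cvgM; first exact: cvg_cst.
by apply: cvg_big => [|i _]; [move=> x; exact: mul_continuous|exact: AB].
Qed.

(** An invertible matrix has the adjugate over the determinant as its inverse, which is continuous
    in the entries. On singular matrices [invmx] takes a default value, hence the condition along
    [F]. *)
Lemma cvg_invmx (T : Type) (F : set_system T) (n : nat) (A : T -> 'M[R]_n)
    (B : 'M[R]_n) : Filter F -> B \in unitmx -> (\forall t \near F, A t \in unitmx) ->
  (forall i j, A t i j @[t --> F] --> B i j) ->
  forall i j, invmx (A t) i j @[t --> F] --> invmx B i j.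
Proof.
move=> FF uB uA AB i j.
rewrite /invmx uB !mxE.
apply: (@cvg_trans _ ((\det (A t))^-1 * cofactor (A t) j i @[t --> F])).
  by apply: near_eq_cvg; apply: filterS uA => t At; rewrite At !mxE.
apply: cvgM.
  by apply: cvgV; [move: uB; rewrite unitmxE unitfE|exact: cvg_det].
apply: cvgM; first exact: cvg_cst.
apply: cvg_det => k l; rewrite !mxE.
by under eq_cvg do rewrite !mxE; exact: AB.
Qed.

Definition posdef (n : nat) (A : 'M[R]_n) :=
  forall v : 'rV[R]_n, v != 0 -> 0 < (v *m A *m v^T) ord0 ord0.

Lemma posdef_unitmx n (A : 'M[R]_n) : posdef A -> A \in unitmx.
Proof.
move=> pA; rewrite -row_free_unit -kermx_eq0; apply/rowV0P => v /sub_kermxP vA.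
by apply/eqP/negP => /negP /pA; rewrite vA mul0mx mxE ltxx.
Qed.

(* The determinant does not vanish on the segment from the identity to [A]. *)
Lemma posdef_det_gt0 n (A : 'M[R]_n) : posdef A -> 0 < \det A.
Proof.
move=> pA; rewrite ltNge; apply/negP => dA.
(* The determinant along the segment is a polynomial in [t], nonpositive at 0 and equal to 1 at 1,
   so it has a root in between. *)
pose P : 'M[{poly R}]_n := map_mx polyC A + 'X *: map_mx polyC (1%:M - A).
have PE t : (\det P).[t] = \det (A + t *: (1%:M - A)).
  rewrite -[LHS]/(horner_eval t (\det P)) -det_map_mx; congr (\det _).
  by apply/matrixP => i j; rewrite !mxE -[LHS]/(_.[t]) !hornerE.
have := @poly_ivt _ (\det P) 0 1 ler01.
rewrite !PE scale0r scale1r addr0 addrC subrK det1 dA ler01 => /(_ isT).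
move=> [t /andP[t0 t1] /rootP]; rewrite PE => dt.
suff /posdef_unitmx : posdef (A + t *: (1%:M - A)) by rewrite unitmxE dt unitr0.
move=> v v0.
have -> : A + t *: (1%:M - A) = (1 - t) *: A + t%:M.
  by rewrite scalerBr scalerBl scale1r scalemx1 addrA addrAC.
rewrite mulmxDr mulmxDl -scalemxAr -scalemxAl mul_mx_scalar -scalemxAl !mxE.
have vv : 0 < \sum_j v ord0 j * v^T j ord0.
  have /rV0Pn [j vj] := v0.
  rewrite (bigD1 j) //= mxE ltr_pwDl //.
    by rewrite -expr2 exprn_even_gt0.
  by apply: sumr_ge0 => k _; rewrite mxE -expr2 sqr_ge0.
have := pA v v0; rewrite mxE => vAv.
have [->|tn1] := eqVneq t 1; first by rewrite subrr mul0r add0r mul1r.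
apply: ltr_pwDl; last by rewrite mulr_ge0 // ltW.
by rewrite mulr_gt0 // subr_gt0 lt_neqAle tn1.
Qed.

End MatrixLemmas.

(** * Integrals of products of hats *)

Section Hat.
Context {R : realType}.

Definition hat (c e t : R) : R := Num.max 0 (e - `|t - c|).

Lemma hat_ge0 c e t : 0 <= hat c e t.
Proof. by rewrite le_max lexx. Qed.

Lemma hat_eq0 c e t : e <= `|t - c| -> hat c e t = 0.
Proof. by move=> H; apply/max_idPl; rewrite subr_le0. Qed.

Lemma hat_ge c e t : `|t - c| <= e / 2 -> e / 2 <= hat c e t.
Proof. by move=> H; rewrite le_max; apply/orP; right; lra. Qed.

Lemma continuous_hat c e : continuous (hat c e).
Proof.
move=> t; apply: (@continuous_max _ _ (cst 0) (fun s => e - `|s - c|) t).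
  exact: cvg_cst.
apply: cvgB; first exact: cvg_cst.
by apply: cvg_norm; apply: cvgB; [exact: cvg_id|exact: cvg_cst].
Qed.

Lemma integrable_hat c e :
  (@lebesgue_measure R).-integrable setT (EFin \o hat c e).
Proof.
pose D : set (measurableTypeR R) := `[c - e, c + e]%classic.
have mD : measurable D by exact: measurable_itv.
have iD : (@lebesgue_measure R).-integrable D (EFin \o hat c e).
  apply: continuous_compact_integrable; first exact: segment_compact.
  exact/continuous_subspaceT/continuous_hat.
have := (integrable_mkcond _ mD).1 iD.
apply: eq_integrable => // t _; rewrite /patch; case: ifPn => // tn /=.
rewrite hat_eq0 // leNgt; apply: contra tn => te.
by rewrite inE /D /= in_itv /= -ler_distl ltW.
Qed.

(** The hat is at least [e / 2] on an interval of length [e] around [c]. *)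
Lemma Rintegral_hat_gt0 c e : 0 < e ->
  0 < \int[@lebesgue_measure R]_t hat c e t.
Proof.
move=> e0; pose D : set (measurableTypeR R) := `[c - e / 2, c + e / 2]%classic.
have mD : measurable D by exact: measurable_itv.
have iD : (@lebesgue_measure R).-integrable setT (EFin \o ((fun=> e / 2) \_ D)).
  have cD : (@lebesgue_measure R).-integrable D (EFin \o fun=> e / 2).
    apply: continuous_compact_integrable; first exact: segment_compact.
    by apply: continuous_subspaceT => x; exact: cvg_cst.
  have := (integrable_mkcond _ mD).1 cD; apply: eq_integrable => // t _.
  by rewrite /patch /=; case: ifP.
have : \int[@lebesgue_measure R]_(t in D) (e / 2)
       <= \int[@lebesgue_measure R]_t hat c e t.
  rewrite Rintegral_mkcond; apply: le_Rintegral => //.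
    exact: integrable_hat.
  move=> t _; rewrite /patch; case: ifPn => [|_]; last exact: hat_ge0.
  by rewrite inE /D /= in_itv /= -ler_distl; exact: hat_ge.
apply: lt_le_trans; rewrite Rintegral_cst //.
have muD : lebesgue_measure D = e%:E.
  have := @lebesgue_measure_itv R `[c - e / 2, c + e / 2]; rewrite /= lte_fin.
  rewrite ifT; last by lra.
  by rewrite -EFinB => H; apply: etrans H _; congr (_%:E); lra.
by rewrite -[X in fine X]/(lebesgue_measure D) muD /= mulr_gt0 // divr_gt0.
Qed.

(** Once the first coordinate is fixed, its hat is a constant; the factor [k] absorbs it in the
    induction. *)
Lemma iter_integral_prod_hat (m : nat) (k e : R) (c : 'I_m -> R) :
  iter_integral (fun x : 'rV[R]_m => k * \prod_i hat (c i) e (x ord0 i)) =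
  k * \prod_i \int[@lebesgue_measure R]_t hat (c i) e t.
Proof.
elim: m k c => [|m IH] k c; first by rewrite /= !big_ord0.
rewrite /= [in RHS]big_ord_recl mulrA.
transitivity (\int[@lebesgue_measure R]_t
   ((k * \prod_(i < m) \int[@lebesgue_measure R]_t hat (c (lift ord0 i)) e t)
     * hat (c ord0) e t)).
  apply: eq_Rintegral => t _; rewrite mulrAC -(IH _ (fun i => c (lift ord0 i))).
  congr iter_integral; apply/funext => y; rewrite big_ord_recl mulrA.
  have E0 : (row_mx (t%:M : 'rV_1) y : 'rV_(1 + m)) ord0 (@ord0 m) = t.
    have -> : @ord0 m = lshift m (@ord0 0) :> 'I_(1 + m) by exact/val_inj.
    by rewrite row_mxEl mxE eqxx mulr1n.
  rewrite E0; congr (_ * _); apply: eq_bigr => i _; congr (hat _ _ _).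
  have <- : rshift 1 i = lift ord0 i :> 'I_(1 + m) by exact/val_inj.
  exact: (row_mxEr (t%:M : 'rV_1) y).
rewrite RintegralZl //; last exact: integrable_hat.
by rewrite mulrAC.
Qed.

End Hat.

(** * Calculus in charts *)

Section ManifoldCalculus.
Context {R : realType} {n : nat} {M : topologicalType} (A : atlas R n M).
Local Notation E := 'rV[R]_n.+1.
Implicit Types (i j : chart A) (p q : M) (u : M -> R).

Definition chart_image i : set E := coord i @` dom i.

Lemma near_gt0 (x : E) : 0 < x ord0 ord0 -> \forall y \near x, 0 < (y : E) ord0 ord0.
Proof.
by move=> x0; exact: (@coord_continuous R 1 n.+1 ord0 ord0 x _ (lt_nbhsr x0)).
Qed.

Lemma near_halfspace (x : E) : 0 < x ord0 ord0 -> \forall y \near x, halfspace (y : E).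
Proof. by move=> x0; apply: filterS (near_gt0 x0) => y; exact: ltW. Qed.

Lemma chart_imageP i p : dom i p -> chart_image i (coord i p).
Proof. by move=> ip; exists p. Qed.

Lemma param_chart_image i x : chart_image i x ->
  dom i (param i x) /\ coord i (param i x) = x.
Proof. by move=> [p ip <-]; rewrite Defs.coordK. Qed.

Lemma chart_image_rel_open i : rel_open (chart_image i).
Proof. by have [W] := image_open i; exists W. Qed.

Lemma coord_cvg i p : dom i p -> coord i @ p --> coord i p.
Proof.
move=> ip; have := @Defs.coord_continuous _ _ _ A i.
by rewrite continuous_open_subspace; [apply; rewrite inE|exact: dom_open].
Qed.

Lemma dom_near i p : dom i p -> \forall q \near p, dom i q.
Proof. by move=> ip; apply: open_nbhs_nbhs; split=> //; exact: dom_open. Qed.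

Lemma param_cvg i p : dom i p ->
  param i @ within (chart_image i) (nbhs (coord i p)) --> p.
Proof.
move=> ip; have := @param_continuous _ _ _ A i.
move=> /subspace_continuousP /(_ _ (chart_imageP ip)).
by rewrite /from_subspace Defs.coordK.
Qed.

(** The set is the preimage of the open [dom j] under the continuous [param i], hence open in the
    chart image, which is itself open in the half-space. *)
Lemma chart_imageI_rel_open i j : rel_open (coord i @` (dom i `&` dom j)).
Proof.
have oj := (continuousP _).1 (@param_continuous _ _ _ A i) _ (@dom_open _ _ _ A j).
have [V oV VE] := (open_subspaceP _ _).1 oj; have [W oW WE] := chart_image_rel_open i.
exists (V `&` W); first exact: openI.
rewrite -setIA -WE; apply/seteqP; split => x.
  move=> [p [ip jp] <-]; split; last exact: chart_imageP.
  suff : (V `&` chart_image i) (coord i p) by case.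
  rewrite /chart_image VE; split; last exact: chart_imageP.
  by rewrite /from_subspace /= Defs.coordK.
move=> [Vx ix]; have [ipx xE] := param_chart_image ix.
have : (V `&` coord i @` dom i) x by split.
by rewrite VE => -[/= jx _]; exists (param i x).
Qed.

Lemma smooth_on_coord_cvg i (F : E -> R) p : dom i p ->
  smooth_on (chart_image i) F -> F (coord i q) @[q --> p] --> F (coord i p).
Proof.
move=> ip sF; have H := smooth_on_cvg sF (chart_imageP ip).
apply: cvg_comp H => P /= HP.
have := coord_cvg ip HP; apply: filterS2 (dom_near ip) => q iq; apply.
exact: chart_imageP.
Qed.

Lemma smooth_fun_cvg i u p : dom i p ->
  smooth_on (chart_image i) (u \o param i) -> u @ p --> u p.
Proof.
move=> ip su; rewrite -{2}(Defs.coordK ip).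
apply: cvg_trans (smooth_on_coord_cvg ip su).
by apply: near_eq_cvg; apply: filterS (dom_near ip) => q iq /=; rewrite Defs.coordK.
Qed.

Lemma smooth_fun_continuous u : smooth_fun A u -> continuous u.
Proof. by move=> su p; exact: smooth_fun_cvg (dom_chart_at A p) (su _). Qed.

Lemma smooth_fun_cst (c : R) : smooth_fun A (fun=> c).
Proof. by move=> i; exact: smooth_on_cst. Qed.

Lemma smooth_funD u v : smooth_fun A u -> smooth_fun A v ->
  smooth_fun A (fun p => u p + v p).
Proof. by move=> su sv i; exact: smooth_onD (su i) (sv i). Qed.

Lemma smooth_funM u v : smooth_fun A u -> smooth_fun A v ->
  smooth_fun A (fun p => u p * v p).
Proof. by move=> su sv i; exact: smooth_onM (su i) (sv i). Qed.

Lemma smooth_fun_comp u (h : nat -> R -> R) (k : nat) :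
  (forall k (t : R), is_derive t 1 (h k) (h k.+1 t)) ->
  smooth_fun A u -> smooth_fun A (fun p => h k (u p)).
Proof.
by move=> dh su i; exact: (@smooth_on_comp _ _ _ (u \o param i) h k dh (su i)).
Qed.

Lemma diff_formD u v i p : smooth_fun A u -> smooth_fun A v -> dom i p ->
  diff_form (fun q => u q + v q) i p = diff_form u i p + diff_form v i p.
Proof.
move=> su sv ip; apply/rowP => a; rewrite !mxE.
exact: (pderivD a (chart_image_rel_open i) (su i) (sv i) (chart_imageP ip)).
Qed.

Lemma diff_formM u v i p : smooth_fun A u -> smooth_fun A v -> dom i p ->
  diff_form (fun q => u q * v q) i p = u p *: diff_form v i p + v p *: diff_form u i p.
Proof.
move=> su sv ip; apply/rowP => a; rewrite !mxE.
have := pderivM a (chart_image_rel_open i) (su i) (sv i) (chart_imageP ip).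
by rewrite /= !Defs.coordK.
Qed.

Lemma diff_form_comp u (h : R -> R) (dh : R) i p : smooth_fun A u -> dom i p ->
  is_derive (u p) 1 h dh ->
  diff_form (fun q => h (u q)) i p = dh *: diff_form u i p.
Proof.
move=> su ip Hh; apply/rowP => a; rewrite !mxE.
apply: (pderiv_comp a (chart_image_rel_open i) (su i) (chart_imageP ip)).
by rewrite /= Defs.coordK.
Qed.

(** The chain rule for [u \o param i], which on the overlap is [u \o param j] after the transition
    map [coord j \o param i]. *)
Lemma diff_form_chart u i j p : smooth_fun A u -> dom i p -> dom j p ->
  diff_form u i p = diff_form u j p *m (jac i j p)^T.
Proof.
move=> su ip jp; apply/rowP => a; rewrite !mxE.
transitivity (\sum_b pderiv a (fun x => coord j (param i x) ord0 b) (coord i p)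
                * pderiv b (u \o param j) (coord j (param i (coord i p)))).
  apply: (pderiv_chain (T := coord j \o param i) a
     (chart_imageI_rel_open i j) (chart_image_rel_open j)).
  - by exists p.
  - exact: transition_smooth.
  - exact: su.
  - move=> _ [q [iq jq] <-] /=; rewrite Defs.coordK //.
    split; last by rewrite Defs.coordK.
    exact: chart_imageP.
by apply: eq_bigr => b _; rewrite !mxE mulrC Defs.coordK.
Qed.

Lemma diff_form_one_form u : smooth_fun A u -> one_form (diff_form (A := A) u).
Proof.
move=> su; split=> [i b|i j p ip jp]; last exact: diff_form_chart.
apply: smooth_on_eq (smooth_on_pderiv b (chart_image_rel_open i) (su i)).
by move=> x /param_chart_image[_ xE]; rewrite mxE /partial xE.
Qed.

Lemma one_formD (v w : covector_field A) : one_form v -> one_form w ->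
  one_form (fun i p => v i p + w i p).
Proof.
move=> [sv tv] [sw tw]; split=> [i b|i j p ip jp].
  by apply: smooth_on_eq (smooth_onD (sv i b) (sw i b)) => x _; rewrite mxE.
by rewrite (tv i j) // (tw i j) // mulmxDl.
Qed.

Lemma one_formZ u (w : covector_field A) : smooth_fun A u -> one_form w ->
  one_form (fun i p => u p *: w i p).
Proof.
move=> su [sw tw]; split=> [i b|i j p ip jp].
  by apply: smooth_on_eq (smooth_onM (su i) (sw i b)) => x _; rewrite mxE.
by rewrite (tw i j) // scalemxAl.
Qed.

(** * Inner products of covectors, the boundary, and locally constant functions *)

Section Metric.
Variable g : bilinear_field A.
Hypothesis mg : riemannian_metric g.

Lemma metric_unitmx i p : dom i p -> g i p \in unitmx.
Proof. by case: mg => _ _ _ pg ip; apply: posdef_unitmx => v; exact: pg. Qed.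

Lemma metric_det_gt0 i p : dom i p -> 0 < \det (g i p).
Proof. by case: mg => _ _ _ pg ip; apply: posdef_det_gt0 => v; exact: pg. Qed.

(** The invertible [g i p] is a product that has the Jacobian as a factor. *)
Lemma jac_unitmx i j p : dom i p -> dom j p -> jac i j p \in unitmx.
Proof.
case: mg => _ tg _ _ ip jp; have := metric_unitmx ip.
by rewrite (tg i j) // !unitmx_mul => /andP[/andP[]].
Qed.

Definition covector_inner (G : 'M[R]_n.+1) (v w : 'rV[R]_n.+1) : R :=
  (v *m (w *m invmx G)^T) ord0 ord0.

(** The Jacobians coming from the covectors cancel those of the inverse metric, so any chart around
    [p] may replace [chart_at A p]. *)
Lemma form_inner_chart (v w : covector_field A) i p : one_form v -> one_form w ->
  dom i p -> form_inner g v w p = covector_inner (g i p) (v i p) (w i p).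
Proof.
move=> [_ tv] [_ tw] ip; rewrite /form_inner /covector_inner /sharp.
set k := chart_at A p; have kp : dom k p := dom_chart_at A p.
have [_ tg _ _] := mg; have uJ := jac_unitmx kp ip; have ug := metric_unitmx ip.
rewrite (tv k i) // (tw k i) // (tg k i) //.
set J := jac k i p in uJ *; set G := g i p in ug *.
have uJT : J^T \in unitmx by rewrite unitmx_tr.
have H : invmx (J *m G *m J^T) = invmx J^T *m invmx G *m invmx J.
  apply: (can_inj (mulKmx (_ : J *m G *m J^T \in unitmx))).
    by rewrite !unitmx_mul uJ ug uJT.
  rewrite mulmxV ?unitmx_mul ?uJ ?ug ?uJT //.
  rewrite -!mulmxA (mulKVmx uJT) (mulKVmx ug) mulmxV //.
rewrite H !mulmxA mulmxK // trmx_mul !mulmxA; congr (_ ord0 ord0).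
rewrite -[v i p *m _ *m _]mulmxA -trmx_mul.
by rewrite mulVmx // trmx1 mulmx1.
Qed.

(** The chart [chart_at A q] may jump with [q]; near [p] everything is computed in the single chart
    chosen at [p]. *)
Lemma form_inner_continuous (v w : covector_field A) : one_form v -> one_form w ->
  continuous (form_inner g v w).
Proof.
move=> fv fw p; set i := chart_at A p; have ip : dom i p := dom_chart_at A p.
have cw (z : covector_field A) b : one_form z ->
    z i q ord0 b @[q --> p] --> z i p ord0 b.
  move=> [sz _]; exact: (smooth_fun_cvg (u := fun q => z i q ord0 b) ip (sz i b)).
have [sg _ _ _] := mg.
have cg a b : g i q a b @[q --> p] --> g i p a b.
  exact: (smooth_fun_cvg (u := fun q => g i q a b) ip (sg i a b)).
have cg' := cvg_invmx _ (metric_unitmx ip) _ cg.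
rewrite /continuous_at (form_inner_chart fv fw ip).
apply: (@cvg_trans _ ((fun q => covector_inner (g i q) (v i q) (w i q)) @ p)).
  apply: near_eq_cvg; apply: filterS (dom_near ip) => q iq.
  by rewrite (form_inner_chart fv fw iq).
rewrite /covector_inner mxE.
apply: (@cvg_trans _ ((fun q => \sum_a v i q ord0 a *
   \sum_b w i q ord0 b * invmx (g i q) b a) @ p)).
  by apply: near_eq_cvg; near=> q; rewrite mxE; apply: eq_bigr => a _; rewrite !mxE.
apply: cvg_big => [|a _]; first by move=> x; exact: add_continuous.
apply: cvgM; first exact: cw.
rewrite !mxE; apply: cvg_big => [|b _]; first by move=> x; exact: add_continuous.
apply: cvgM; first exact: cw.
by apply: cg'; near=> q; apply: metric_unitmx; near: q; exact: dom_near.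
Unshelve. all: by end_near. Qed.

Lemma covector_innerC i p v w : dom i p ->
  covector_inner (g i p) v w = covector_inner (g i p) w v.
Proof.
case: mg => _ _ sg _ ip; rewrite /covector_inner.
rewrite -[in LHS](trmxK (v *m _)) [LHS]mxE !trmx_mul !trmxK -mulmxA.
by rewrite trmx_inv sg // mulmxA.
Qed.

Lemma covector_inner_gt0 i p v : dom i p -> v != 0 ->
  0 < covector_inner (g i p) v v.
Proof.
case: mg => _ _ _ pg ip v0; have ug := metric_unitmx ip.
have := pg i p (v *m invmx (g i p)) ip; rewrite mulmxKV //; apply.
by apply: contra_neq v0 => /(congr1 (mulmx^~ (g i p))); rewrite mulmxKV // mul0mx.
Qed.

Lemma covector_innerDl G v1 v2 w :
  covector_inner G (v1 + v2) w = covector_inner G v1 w + covector_inner G v2 w.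
Proof. by rewrite /covector_inner mulmxDl mxE. Qed.

Lemma covector_innerZl G c v w :
  covector_inner G (c *: v) w = c * covector_inner G v w.
Proof. by rewrite /covector_inner -scalemxAl mxE. Qed.

(* At an interior point of a second chart where [coord j] touches the edge of the
   half-space, its component 0 is minimal, so its gradient, which is a column of
   the invertible Jacobian, would vanish. *)
Lemma boundary_chart i p : dom i p -> boundary A p -> coord i p ord0 ord0 = 0.
Proof.
move=> ip [j jp j0]; apply/eqP/negP => /negP i0.
have ox := chart_imageI_rel_open i j.
have ijp : (coord i @` (dom i `&` dom j)) (coord i p) by exists p.
have hx := rel_open_half ox ijp.
have xgt0 : 0 < coord i p ord0 ord0 by rewrite lt_neqAle eq_sym i0.
pose F (y : E) := coord j (param i y) ord0 ord0.
have sF : smooth_on (coord i @` (dom i `&` dom j)) F by exact: transition_smooth.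
have [W [G [oW Wx sG FG]]] := smooth_on_ext ox sF ijp.
have hy : \forall y \near coord i p, halfspace y.
  exact: near_halfspace.
have F0 : F (coord i p) = 0 by rewrite /F Defs.coordK.
have minG : \forall y \near coord i p,
    differentiable G y /\ G (coord i p) <= G y.
  have Gx := (FG _ hx Wx).2; rewrite F0 in Gx.
  apply: filterS2 hy (open_nbhs_nbhs (conj oW Wx)) => y hhy Wy.
  split; first exact: (sG [::]).
  have [[q [iq jq] yE] FyE] := FG _ hhy Wy; rewrite -Gx -FyE /F -yE Defs.coordK //.
  exact: rel_open_half (chart_image_rel_open j) (chart_imageP jq).
have J0 a : jac i j p a ord0 = 0.
  rewrite mxE /partial (pderiv_near (G := G) a hx) //.
  - exact: derive_at_min.
  - by have [] := nbhs_singleton minG.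
  - by apply: filterS (open_nbhs_nbhs (conj oW Wx)) => y Wy hhy; have [] := FG _ hhy Wy.
have uJ := jac_unitmx ip jp.
have : jac i j p *m delta_mx ord0 (ord0 : 'I_1) = 0.
  by rewrite -colE; apply/matrixP => a b; rewrite mxE J0 mxE.
move=> /(congr1 (mulmx (invmx (jac i j p)))); rewrite mulKmx // mulmx0.
by move=> /matrixP /(_ ord0 ord0) /eqP; rewrite !mxE /= oner_eq0.
Qed.

Lemma interior_coord_gt0 i p : dom i p -> ~ boundary A p -> 0 < coord i p ord0 ord0.
Proof.
move=> ip bp; rewrite lt_neqAle; apply/andP; split; last first.
  exact: rel_open_half (chart_image_rel_open i) (chart_imageP ip).
by apply/negP => /eqP i0; apply: bp; exists i.
Qed.

(** Coordinate 0 is positive at an interior point, so the chart image is a full neighbourhood there,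
    and continuity of [param i] transports the property. *)
Lemma interior_near i p (P : M -> Prop) : dom i p -> ~ boundary A p ->
  (\forall q \near p, P q) ->
  \forall y \near coord i p, chart_image i y /\ P (param i y).
Proof.
move=> ip bp nP; have xgt0 := interior_coord_gt0 ip bp.
have [W oW WE] := chart_image_rel_open i.
have Wx : W (coord i p) by have := chart_imageP ip; rewrite WE => -[].
have hy : \forall y \near coord i p, halfspace y.
  exact: near_halfspace.
have Pp : \forall y \near coord i p, chart_image i y -> P (param i y).
  exact: (param_cvg ip nP).
near=> y; have iy : chart_image i y.
  by rewrite WE; split; near: y => //; exact: open_nbhs_nbhs.
by split => //; move: iy; near: y.
Unshelve. all: by end_near. Qed.

(** By [boundary_chart], all boundary points in the domain of one chart are zeros of its coordinate
    0, and positivity of that coordinate is an open condition. *)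
Lemma interior_open : open (~` boundary A).
Proof.
rewrite openE => p bp; have ip := dom_chart_at A p.
have i0 := interior_coord_gt0 ip bp.
have := coord_cvg ip (near_gt0 i0); apply: filterS2 (dom_near ip) => q iq /= q0 bq.
by move: q0; rewrite (boundary_chart iq bq) ltxx.
Qed.

(** Independence of the chart moves the hypothesis to the fixed chart [i]; definiteness kills the
    partial derivatives there, and [u] is constant on a coordinate ball. *)
Lemma zero_diff_form_locally_cst u p : smooth_fun A u -> ~ boundary A p ->
  (\forall q \near p, covector_inner (g (chart_at A q) q)
     (diff_form u (chart_at A q) q) (diff_form u (chart_at A q) q) = 0) ->
  \forall q \near p, u q = u p.
Proof.
move=> su bp du; pose i := chart_at A p; have ip : dom i p := dom_chart_at A p.
have du0 : \forall q \near p, diff_form u i q = 0.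
  apply: filterS2 (dom_near ip) du => q iq.
  have fu := diff_form_one_form su.
  rewrite -[X in X = 0]/(form_inner g (diff_form u) (diff_form u) q).
  rewrite (form_inner_chart fu fu iq) => H; apply/eqP/negP => /negP.
  by move=> /(covector_inner_gt0 iq); rewrite H ltxx.
have [W [G [oW Wx sG FG]]] :=
  smooth_on_ext (chart_image_rel_open i) (su i) (chart_imageP ip).
have ox : \forall y \near coord i p, W y by exact: open_nbhs_nbhs.
have /nbhs_ballP [r /= r0 Hr] : \forall y \near coord i p,
    W y /\ chart_image i y /\ diff_form u i (param i y) = 0.
  apply: filterS2 ox (interior_near (P := fun q => diff_form u i q = 0) ip bp du0).
  by move=> y; split.
have cst : forall y, ball (coord i p) r y -> G y = G (coord i p).
  apply: zero_derivative_cst => [y /Hr[Wy _]|y a /Hr[Wy [iy du0y]]].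
    exact: (sG [::]).
  have [ipy yE] := param_chart_image iy.
  have := congr1 (fun v : 'rV_n.+1 => v ord0 a) du0y; rewrite !mxE /partial yE => <-.
  apply/esym/pderiv_near; first exact: rel_open_half (chart_image_rel_open i) iy.
    exact: (sG [::]).
  by apply: filterS (open_nbhs_nbhs (conj oW Wy)) => z Wz hz; have [] := FG _ hz Wz.
have hh q : dom i q -> halfspace (coord i q).
  by move=> iq; exact: rel_open_half (chart_image_rel_open i) (chart_imageP iq).
have ball_near : \forall q \near p, ball (coord i p) r (coord i q).
  by apply: coord_cvg => //; exact: nbhsx_ballx.
apply: filterS2 (dom_near ip) ball_near => q iq bq.
have [_ Gp] := FG _ (hh _ ip) Wx; have [_ Gq] := FG _ (hh _ iq) (Hr _ bq).1.
by move: Gp Gq; rewrite /= !Defs.coordK // => -> ->; exact: cst.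
Qed.

End Metric.
End ManifoldCalculus.

(** * The Riemannian measure in the interior *)

Section RiemannianIntegral.
Context {R : realType} {n : nat} {M : ptopologicalType} (A : atlas R n M).
Variables (g : bilinear_field A) (vol : {measure set (borel M) -> \bar R}).
Hypotheses (hM : hausdorff_space M) (mg : riemannian_metric g).
Hypothesis hvol : riemannian_volume g vol.
Local Notation E := 'rV[R]_n.+1.
Implicit Types (p q : M) (h psi : M -> R) (K : set M).

(** Dividing the product of hats by [sqrt (det g)] cancels the density in [riemannian_volume], which
    leaves a product of positive one-dimensional integrals. *)
Lemma bump_function p (P : M -> Prop) :
  ~ boundary A p -> (\forall q \near p, P q) ->
  exists psi K, [/\ continuous psi, compact K & K `<=` P] /\
    [/\ forall q, ~ K q -> psi q = 0, forall q, 0 <= psi q, 0 < psi p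
      & 0 < \int[vol]_q psi q].
Proof.
move=> bp nP; pose i := chart_at A p; have ip : dom i p := dom_chart_at A p.
set x := coord i p.
have /nbhs_ballP [e /= e0 He] := interior_near ip bp nP.
pose r := e / 2; have r0 : 0 < r by rewrite divr_gt0.
(* The norm is the maximum norm, so the closed cube of half-width [r = e / 2] is compact and lies in
   the ball of radius [e]. *)
pose B : set E := [set y | forall k, `[x ord0 k - r, x ord0 k + r]%classic (y ord0 k)].
have BE y : B y -> chart_image i y /\ P (param i y).
  move=> By; apply: He; rewrite -ball_normE /ball_ /= /Num.norm /= mx_normrE.
  apply: (@le_lt_trans _ _ r); last by rewrite /r ltr_pdivrMr // ltr_pMr // ltr1n.
  apply: bigmax_le; first exact: ltW.
  move=> [a k] _ /=; rewrite (ord1 a) !mxE; have := By k.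
  by rewrite /= in_itv /= -ler_distl distrC.
pose K := param i @` B.
have cB : compact B.
  exact: (@rV_compact R n.+1 (fun k => `[x ord0 k - r, x ord0 k + r]%classic)
    (fun k => @segment_compact _ _ _)).
have cK : compact K.
  apply: continuous_compact cB.
  apply: continuous_subspaceW (param_continuous (i := i)).
  by move=> y /BE[].
have Kdom q : K q -> dom i q.
  by move=> [y /BE[/param_chart_image[iy _] _] <-].
pose H (y : E) := \prod_k hat (x ord0 k) r (y ord0 k).
pose psi q := if pselect (dom i q) then
  H (coord i q) / Num.sqrt (\det (g i q)) else 0.
have sd q : dom i q -> 0 < Num.sqrt (\det (g i q)).
  by move=> iq; rewrite sqrtr_gt0; exact: metric_det_gt0.
have psiE q : dom i q -> psi q = H (coord i q) / Num.sqrt (\det (g i q)).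
  by move=> iq; rewrite /psi; case: pselect.
have HB y : ~ B y -> H y = 0.
  move=> nBy; have /existsNP [k nk] :
    ~ forall k, `[x ord0 k - r, x ord0 k + r]%classic (y ord0 k).
    by [].
  rewrite /H (bigD1 k) //= hat_eq0 ?mul0r // leNgt; apply/negP => lt; apply: nk.
  by rewrite /= in_itv /= -ler_distl ltW.
have psi0 q : ~ K q -> psi q = 0.
  move=> nKq; rewrite /psi; case: pselect => // iq; rewrite HB ?mul0r //.
  by move=> Bq; apply: nKq; exists (coord i q) => //; rewrite Defs.coordK.
have cpsi : continuous psi.
  (* Outside the chart domain the extension by 0 is continuous because [K] is closed, [M] being
     Hausdorff. *)
  move=> q; have [iq|niq] := pselect (dom i q); last first.
    have oK : open (~` K) by apply: closed_openC; exact: compact_closed.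
    have nKq : ~ K q by move=> /Kdom.
    rewrite /continuous_at (psi0 _ nKq); apply: cvg_near_cst.
    by apply: filterS (open_nbhs_nbhs (conj oK nKq)) => z; exact: psi0.
  rewrite /continuous_at psiE //.
  apply: (@cvg_trans _ ((fun q => H (coord i q) / Num.sqrt (\det (g i q))) @ q)).
    by apply: near_eq_cvg; apply: filterS (dom_near iq) => z iz; rewrite psiE.
  apply: cvgM.
    apply: cvg_big => [|k _]; first by move=> z; exact: mul_continuous.
    have ck := cvg_comp _ _ (coord_cvg iq) (@coord_continuous R 1 n.+1 ord0 k _).
    exact: cvg_comp _ _ ck (@continuous_hat R _ _ _).
  apply: cvgV; first by rewrite gt_eqF // sd.
  have [sg _ _ _] := mg.
  have cg a b : g i z a b @[z --> q] --> g i q a b.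
    exact: (smooth_fun_cvg (u := fun z => g i z a b) iq (sg i a b)).
  exact: cvg_comp _ _ (cvg_det _ cg) (@sqrt_continuous R _).
have psi_ge0 q : 0 <= psi q.
  rewrite /psi; case: pselect => // iq; rewrite divr_ge0 ?sqrtr_ge0 //.
  by apply: prodr_ge0 => k _; exact: hat_ge0.
exists psi, K; split; first by split => // q [y /BE[_ Py] <-].
split => //.
  rewrite psiE // divr_gt0 ?sd //; apply: prodr_gt0 => k _.
  apply: lt_le_trans (hat_ge _); first by rewrite divr_gt0.
  by rewrite subrr normr0 divr_ge0 // ltW.
rewrite (hvol cpsi cK Kdom psi0).
have -> : patch (fun=> 0) (coord i @` dom i)
    (fun y => psi (param i y) * Num.sqrt (\det (g i (param i y)))) =
    fun y : E => 1 * \prod_k hat (x ord0 k) r (y ord0 k).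
  apply/funext => y; rewrite mul1r -/(H y) /patch; case: ifPn => [|nA].
    rewrite inE => /param_chart_image[iy yE].
    by rewrite psiE // yE divfK // gt_eqF // sd.
  rewrite HB // => /BE[iy _]; move: nA; rewrite notin_setE; exact.
rewrite iter_integral_prod_hat mul1r; apply: prodr_gt0 => k _.
exact: Rintegral_hat_gt0.
Qed.

Lemma measurable_open (U : set M) : open U -> measurable (U : set (borel M)).
Proof. by move=> oU; apply: sub_sigma_algebra. Qed.

Lemma continuous_measurable h : continuous h ->
  measurable_fun setT (h : borel M -> R).
Proof.
move=> /continuousP ch; apply: (measurability _ (RGenOpens.measurableE R)).
move=> _ [_ [a [b ->]] <-]; rewrite setTI.
by apply: measurable_open; apply: ch; exact: interval_open.
Qed.

Lemma measurable_compact K : compact K -> measurable (K : set (borel M)).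
Proof.
move=> cK; rewrite -[K]setCK; apply: measurableC; apply: measurable_open.
exact: closed_openC (compact_closed hM cK).
Qed.

(** Markov's inequality for a bump function, on the set where it exceeds half its value at [p]. *)
Lemma volume_locally_finite p : ~ boundary A p ->
  exists2 U : set M, open U /\ U p & (vol U < +oo)%E.
Proof.
move=> bp; have [psi [K [[cpsi _ _] [_ psi0 psip int_gt0]]]] :=
  bump_function bp filterT.
pose U : set M := [set q | psi p / 2 < psi q].
have oU : open U.
  exact: (continuousP psi).1 cpsi _ (@open_gt R (psi p / 2)).
exists U; first by split => //; rewrite /U /= ltr_pdivrMr // ltr_pMr // ltr1n.
have mU := measurable_open oU.
have mpsi := (measurable_EFinP _ _).2 (continuous_measurable cpsi).
(* An infinite integral would give [Rintegral] the default value 0, against its positivity. *)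
have int_fin : (\int[vol]_q (psi q)%:E < +oo)%E.
  rewrite ltey; apply/eqP => intE; move: int_gt0.
  by rewrite /Rintegral intE ltxx.
have : ((psi p / 2)%:E * vol U <= \int[vol]_q (psi q)%:E)%E.
  rewrite -integral_cst //; apply: (@le_trans _ _ (\int[vol]_(q in U) (psi q)%:E)%E).
    apply: ge0_le_integral => //.
    - by move=> q _; rewrite lee_fin divr_ge0 // ltW.
    - exact: measurable_funS mpsi.
    - by move=> q Uq; rewrite lee_fin ltW.
  apply: ge0_subset_integral => //.
  by move=> q _; rewrite lee_fin.
move=> /le_lt_trans/(_ int_fin); rewrite !ltey; apply: contra => /eqP ->.
by rewrite gt0_muley // lte_fin divr_gt0.
Qed.

(* If K had infinite volume, the sets exhausting K up to finite volume would form
   a proper filter, and a cluster point would contradict local finiteness. *)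
Lemma volume_compact_finite K : compact K -> K `<=` ~` boundary A ->
  (vol K < +oo)%E.
Proof.
move=> cK Kb; have mK := measurable_compact cK; apply: contrapT => volK.
pose F : set_system M := fun S => exists2 D : set (borel M),
  measurable D & (vol D < +oo)%E /\ K `\` S `<=` D.
have FF : ProperFilter F.
  apply: Build_ProperFilter.
    move=> [D mD [vD KD]]; apply: volK; apply: le_lt_trans vD.
    by apply: le_measure; rewrite ?inE // => q Kq; apply: KD; split.
  split.
  - by exists set0 => //; rewrite measure0; split => // q [_]; apply.
  - move=> S T [D mD [vD KD]] [D' mD' [vD' KD']]; exists (D `|` D').
      exact: measurableU.
    split.
      by apply: le_lt_trans; [exact: measureU2|exact: lte_add_pinfty].
    move=> q [Kq] /not_andP [nS|nT]; [left; exact: KD|right; exact: KD'].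
  - move=> S T ST [D mD [vD KD]]; exists D => //; split => // q [Kq nT].
    by apply: KD; split => // /ST.
have [|p [Kp clp]] := cK F FF.
  by exists set0 => //; rewrite measure0; split => // q [].
have [U [oU Up] vU] := volume_locally_finite (Kb _ Kp).
have FU : F (~` U).
  by exists U; [exact: measurable_open|split => // q [_ /contrapT]].
by have [q []] := clp _ _ FU (open_nbhs_nbhs (conj oU Up)).
Qed.

(** A continuous function is bounded on [K], and [K] has finite volume. *)
Lemma integrable_compact_support h K : continuous h -> compact K ->
  K `<=` ~` boundary A -> (forall q, ~ K q -> h q = 0) ->
  vol.-integrable setT (EFin \o h).
Proof.
move=> ch cK Kb h0; have mK := measurable_compact cK.
have iK : vol.-integrable (K : set (borel M)) (EFin \o h).
  apply: measurable_bounded_integrable => //.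
  - exact: volume_compact_finite.
  - by apply: measurable_funS (continuous_measurable ch).
  - have := compact_bounded (continuous_compact (continuous_subspaceT ch) cK).
    move=> [C [Cr HC]]; exists C; split => // c Cc q Kq.
    by apply: (HC c Cc); exists q.
have := (integrable_mkcond _ mK).1 iK; apply: eq_integrable => // q _.
rewrite /patch; case: ifPn => // qK /=.
by rewrite h0 //; move: qK; rewrite notin_setE.
Qed.

(** If [h p > 0], a small multiple of a bump function at [p] lies below [h] and has positive
    integral. *)
Lemma integral0_interior h K p : continuous h -> compact K ->
  K `<=` ~` boundary A -> (forall q, ~ K q -> h q = 0) ->
  (forall q, 0 <= h q) -> \int[vol]_q h q = 0 -> ~ boundary A p -> h p = 0.
Proof.
move=> ch cK Kb hK h0 inth bp; apply/eqP/negP => /negP hp.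
have hp0 : 0 < h p by rewrite lt_neqAle eq_sym hp h0.
have near_p : \forall q \near p, h p / 2 < h q /\ (~` boundary A) q.
  near=> q; split; near: q.
    by apply: (cvgr_gt _ (ch p)); rewrite ltr_pdivrMr // ltr_pMr // ltr1n.
  by apply: open_nbhs_nbhs; split => //; exact: interior_open mg.
have [psi [L [[cpsi cL LP] [psiL psi0 psip int_gt0]]]] := bump_function bp near_p.
have Lp : L p by apply: contrapT => /psiL psip0; move: psip; rewrite psip0 ltxx.
have [c _ Hc] := compact_EVT_max (ex_intro _ p Lp) cL (continuous_subspaceT cpsi).
have C0 : 0 < psi c by apply: lt_le_trans psip (Hc _ _); rewrite inE.
(* As [psi c] is the maximum of [psi] on its support [L], [k * psi] is at most [h p / 2], which [h]
   exceeds on [L]. *)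
pose k := h p / 2 / psi c.
have k0 : 0 < k by rewrite !divr_gt0.
have ipsi : vol.-integrable setT (EFin \o psi).
  by apply: integrable_compact_support cpsi cL _ psiL => q /LP[].
have : \int[vol]_q (k * psi q) <= \int[vol]_q h q.
  apply: le_Rintegral => //.
  - exact: (integrableZl measurableT k ipsi).
  - exact: integrable_compact_support ch cK Kb hK.
  move=> q _; have [Lq|/psiL ->] := pselect (L q); last by rewrite mulr0.
  apply: le_trans (ltW (LP _ Lq).1).
  rewrite /k mulrAC ler_pdivrMr // ler_pM2l ?divr_gt0 //.
  by apply: Hc; rewrite inE.
rewrite inth RintegralZl // leNgt => /negP; apply.
by rewrite mulr_gt0.
Unshelve. all: by end_near. Qed.

End RiemannianIntegral.

(** * The magnetic Laplacian *)

Section MagneticLaplacian.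
Context {R : realType} {n : nat} {M : topologicalType} (A : atlas R n M).
Variables (g : bilinear_field A) (delta : covector_field A -> M -> R).
Variables (eta : covector_field A) (f : M -> R[i]).

Definition re_part : M -> R := @complex.Re R \o f.
Definition im_part : M -> R := @complex.Im R \o f.

(** These two fields are [alpha] and [beta]. The sign is a factor [-1] so that the coefficient is
    visibly a product of smooth functions. *)
Definition re_differential : covector_field A :=
  fun i p => diff_form re_part i p + (-1 * im_part p) *: eta i p.
Definition im_differential : covector_field A :=
  fun i p => diff_form im_part i p + re_part p *: eta i p.

Lemma re_magnetic_differential :
  (fun i p => map_mx (@complex.Re R) (magnetic_differential eta f i p)) =
  re_differential.
Proof.
apply/funext => i; apply/funext => p; apply/rowP => a.
rewrite !mxE /re_differential /im_part /=.
by case: (f p) => x y /=; ring.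
Qed.

Lemma im_magnetic_differential :
  (fun i p => map_mx (@complex.Im R) (magnetic_differential eta f i p)) =
  im_differential.
Proof.
apply/funext => i; apply/funext => p; apply/rowP => a.
rewrite !mxE /im_differential /re_part /=.
by case: (f p) => x y /=; ring.
Qed.

(** Real and imaginary parts of [delta alpha + i delta beta - i (<alpha, eta> + i <beta, eta>) =
    0]. *)
Lemma magnetic_laplacian_eq0 p : magnetic_laplacian g delta eta f p = 0 ->
  delta re_differential p = - form_inner g im_differential eta p /\
  delta im_differential p = form_inner g re_differential eta p.
Proof.
rewrite /magnetic_laplacian /magnetic_codifferential /complexified.
rewrite re_magnetic_differential im_magnetic_differential.
have -> : Defs.contraction g eta (magnetic_differential eta f) p =
    form_inner g re_differential eta p +i* form_inner g im_differential eta p.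
  rewrite /Defs.contraction /form_inner -re_magnetic_differential.
  rewrite -im_magnetic_differential; set k := chart_at A p.
  apply/eqP; rewrite eq_complex /= !mxE; apply/andP; split; apply/eqP.
    rewrite raddf_sum; apply: eq_bigr => a _; rewrite [_^T _ _]mxE [map_mx _ _ _ _]mxE.
    by case: (magnetic_differential _ _ _ _ _ _) => x y /=; ring.
  rewrite raddf_sum; apply: eq_bigr => a _; rewrite [_^T _ _]mxE [map_mx _ _ _ _]mxE.
  by case: (magnetic_differential _ _ _ _ _ _) => x y /=; ring.
by move/eqP; rewrite eq_complex /= => /andP[/eqP r0 /eqP i0]; split; lra.
Qed.

Hypotheses (mg : riemannian_metric g) (eta1 : one_form eta) (sf : smooth_cfun A f).

Lemma smooth_re_part : smooth_fun A re_part. Proof. exact: sf.1. Qed.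
Lemma smooth_im_part : smooth_fun A im_part. Proof. exact: sf.2. Qed.

Lemma one_form_re_differential : one_form re_differential.
Proof.
apply: one_formD; first exact: diff_form_one_form smooth_re_part.
by apply: one_formZ => //; apply: smooth_funM smooth_im_part; exact: smooth_fun_cst.
Qed.

Lemma one_form_im_differential : one_form im_differential.
Proof.
apply: one_formD; first exact: diff_form_one_form smooth_im_part.
by apply: one_formZ => //; exact: smooth_re_part.
Qed.

Definition sq_norm p := re_part p * re_part p + im_part p * im_part p.

Lemma smooth_sq_norm : smooth_fun A sq_norm.
Proof.
by apply: smooth_funD; apply: smooth_funM;
  (exact: smooth_re_part || exact: smooth_im_part).
Qed.

Lemma ler_sq_norm p q : sq_norm p <= sq_norm q -> `|f p| <= `|f q|.
Proof.
rewrite /sq_norm /re_part /im_part /=; case: (f p) (f q) => [x y] [z t] /= H.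
by rewrite !normc_def lecR ler_wsqrtr // !expr2.
Qed.

Variable c : R.

(** Here [cutoff] is [phi], and [cutoff_slope] is [psi' (u - c)], the coefficient of [du] in
    [d phi]. *)
Definition excess p := sq_norm p + - c.
Definition cutoff p := flat_exp 0 (excess p).
Definition cutoff_slope p := flat_exp 1 (excess p).

Lemma smooth_excess : smooth_fun A excess.
Proof. by apply: smooth_funD smooth_sq_norm _; exact: smooth_fun_cst. Qed.

Lemma smooth_cutoff : smooth_fun A cutoff.
Proof. exact: (smooth_fun_comp 0 is_derive_flat_exp smooth_excess). Qed.

Lemma cutoff_eq0 p : sq_norm p <= c -> cutoff p = 0 /\ cutoff_slope p = 0.
Proof.
by move=> pc; rewrite /cutoff /cutoff_slope /flat_exp /flat /excess ltNge subr_le0 pc.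
Qed.

Lemma cutoff_ge0 p : 0 <= cutoff p.
Proof.
rewrite /cutoff /flat_exp /flat; case: ifP => // _.
by rewrite /= hornerC mul1r expR_ge0.
Qed.

Lemma cutoff_slope_gt0 p : c < sq_norm p -> 0 < cutoff_slope p.
Proof.
move=> pc; have e0 : 0 < excess p by rewrite subr_gt0.
rewrite /cutoff_slope /flat_exp; apply: flat_gt0 => //.
(* The first derivative of [exp (-1/t)] is the flat function of the polynomial ['X^2]. *)
rewrite /= /flat_deriv derivC subr0 mulr1 hornerXn.
by rewrite exprn_gt0 // invr_gt0.
Qed.

Lemma cutoff_slope_ge0 p : 0 <= cutoff_slope p.
Proof.
have [pc|pc] := ltP c (sq_norm p); first exact/ltW/cutoff_slope_gt0.
by rewrite (cutoff_eq0 pc).2.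
Qed.

Lemma diff_form_sq_norm (i : chart A) p : dom i p -> diff_form sq_norm i p =
  (2 * re_part p) *: diff_form re_part i p + (2 * im_part p) *: diff_form im_part i p.
Proof.
move=> ip; have sr := smooth_re_part; have si := smooth_im_part.
rewrite diff_formD ?diff_formM //; try exact: smooth_funM.
by rewrite -!scalerDl -!mulr2n !mulr_natl.
Qed.

Lemma diff_form_cutoff (i : chart A) p : dom i p ->
  diff_form cutoff i p = cutoff_slope p *: diff_form sq_norm i p.
Proof.
move=> ip.
rewrite (diff_form_comp smooth_excess ip (is_derive_flat_exp 0 (excess p))).
rewrite (diff_formD smooth_sq_norm (@smooth_fun_cst _ _ _ A (- c)) ip).
congr (_ *: _); rewrite -[RHS]addr0; congr (_ + _).
have hp := rel_open_half (chart_image_rel_open i) (chart_imageP ip).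
apply/rowP => k; rewrite !mxE /partial (pderiv_near (G := cst (- c)) k hp).
- exact: derive_cst.
- exact: differentiable_cst.
- by apply: (@nearW _ (nbhs (coord i p))) => y _.
Qed.

Lemma covector_innerDr i p v w z : dom i p -> covector_inner (g i p) v (w + z) =
  covector_inner (g i p) v w + covector_inner (g i p) v z.
Proof. by move=> ip; rewrite !(covector_innerC mg v) // covector_innerDl. Qed.

Lemma covector_innerZr i p k v w : dom i p -> covector_inner (g i p) v (k *: w) =
  k * covector_inner (g i p) v w.
Proof. by move=> ip; rewrite !(covector_innerC mg v) // covector_innerZl. Qed.

(* Twice the integrand obtained by testing the equation with the components of
   [cutoff * f]. *)
Lemma tested_equation p : magnetic_laplacian g delta eta f p = 0 ->
  let inner := covector_inner (g (chart_at A p) p) in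
  let du := diff_form sq_norm (chart_at A p) p in
  let al := re_differential (chart_at A p) p in
  let be := im_differential (chart_at A p) p in
  2 * (form_inner g (diff_form (fun q => re_part q * cutoff q)) re_differential p
     + form_inner g (diff_form (fun q => im_part q * cutoff q)) im_differential p
     - (re_part p * cutoff p * delta re_differential p
      + im_part p * cutoff p * delta im_differential p)) =
  cutoff_slope p * inner du du + 2 * cutoff p * (inner al al + inner be be).
Proof.
move=> /magnetic_laplacian_eq0[-> ->] /=.
set k := chart_at A p; have kp : dom k p := dom_chart_at A p.
have sr := smooth_re_part; have si := smooth_im_part; have sc := smooth_cutoff.
rewrite /form_inner -/k -!/(covector_inner (g k p) _ _).
rewrite !diff_formM // diff_form_cutoff // diff_form_sq_norm //.
rewrite /re_differential /im_differential.
(* What remains is a bilinear identity in three covectors. It holds because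
   [a alpha + b beta = du / 2], and because the [eta] terms left by [da = alpha + b eta] and
   [db = beta - a eta] sum to [a delta alpha + b delta beta]. *)
move: (diff_form re_part k p) (diff_form im_part k p) (eta k p) => x y z.
rewrite !(covector_innerDl, covector_innerZl) !(covector_innerDr, covector_innerZr) //.
rewrite (covector_innerC mg y x) // (covector_innerC mg z x) //.
rewrite (covector_innerC mg z y) //.
by ring.
Qed.

End MagneticLaplacian.

(** The energy argument: a nonnegative continuous integrand with integral 0 vanishes in the
    interior, and its first term contains [|du|^2] with a positive weight wherever [u > c]. *)
Lemma sq_norm_locally_cst (R : realType) (n : nat) (M : ptopologicalType)
    (A : atlas R n M) (g : bilinear_field A)
    (vol : {measure set (borel M) -> \bar R})
    (delta : covector_field A -> M -> R)
    (eta : covector_field A) (f : M -> R[i]) (c : R) :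
  hausdorff_space M -> compact [set: M] -> riemannian_metric g ->
  riemannian_volume g vol -> codifferential g vol delta -> one_form eta ->
  smooth_cfun A f -> (forall p, magnetic_laplacian g delta eta f p = 0) ->
  (forall q, boundary A q -> sq_norm f q < c) ->
  forall p, c < sq_norm f p -> \forall q \near p, sq_norm f q = sq_norm f p.
Proof.
move=> hM cM mg hvol hdelta eta1 sf lap0 bc.
set a := re_part f; set b := im_part f; set phi := cutoff f c.
set al := re_differential eta f; set be := im_differential eta f.
have sa : smooth_fun A a := smooth_re_part sf.
have sb : smooth_fun A b := smooth_im_part sf.
have sphi : smooth_fun A phi := smooth_cutoff sf c.
have su : smooth_fun A (sq_norm f) := smooth_sq_norm sf.
have al1 : one_form al := one_form_re_differential eta1 sf.
have be1 : one_form be := one_form_im_differential eta1 sf.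
have cu : continuous (sq_norm f) := smooth_fun_continuous su.
(* This superlevel set avoids the boundary by the strict bound there. Since [phi] and its slope
   vanish off [K], all integrands below have compact support in the interior and are integrable. *)
pose K : set M := [set q | c <= sq_norm f q].
have cK : compact K.
  apply: (subclosed_compact _ cM) => //.
  exact: (closed_comp (fun q _ => cu q) (@closed_ge R c)).
have Kb : K `<=` ~` boundary A by move=> q Kq /bc; rewrite ltNge Kq.
have nK q : ~ K q -> phi q = 0 /\ cutoff_slope f c q = 0.
  by move=> /negP Kq; apply: cutoff_eq0; rewrite ltW // ltNge.
have saphi : smooth_fun A (fun q => a q * phi q) by exact: smooth_funM.
have sbphi : smooth_fun A (fun q => b q * phi q) by exact: smooth_funM.
have da1 := diff_form_one_form saphi; have db1 := diff_form_one_form sbphi.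
have [sda Ha] := hdelta _ al1; have [sdb Hb] := hdelta _ be1.
have ta : test_function A (fun q => a q * phi q).
  by split => //; exists K; split => // q /nK[-> _]; rewrite mulr0.
have tb : test_function A (fun q => b q * phi q).
  by split => //; exists K; split => // q /nK[-> _]; rewrite mulr0.
pose I1 := form_inner g (diff_form (fun q => a q * phi q)) al.
pose I2 := form_inner g (diff_form (fun q => b q * phi q)) be.
pose J1 q := a q * phi q * delta al q.
pose J2 q := b q * phi q * delta be q.
have diff0 v q : smooth_fun A v -> ~ K q ->
    diff_form (fun q => v q * phi q) (chart_at A q) q = 0.
  move=> sv /nK[p0 s0]; rewrite diff_formM //; last exact: dom_chart_at.
  rewrite p0 scale0r addr0 diff_form_cutoff //; last exact: dom_chart_at.
  by rewrite s0 scale0r scaler0.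
have integ h : continuous h -> (forall q, ~ K q -> h q = 0) ->
    vol.-integrable setT (EFin \o h).
  by move=> ch h0; exact: (integrable_compact_support hM mg hvol ch cK Kb h0).
have cI1 : continuous I1 by exact: form_inner_continuous.
have cI2 : continuous I2 by exact: form_inner_continuous.
have cJ1 : continuous J1.
  by apply: smooth_fun_continuous; exact: smooth_funM saphi sda.
have cJ2 : continuous J2.
  by apply: smooth_fun_continuous; exact: smooth_funM sbphi sdb.
have I10 q : ~ K q -> I1 q = 0.
  by move=> Kq; rewrite /I1 /form_inner diff0 // mul0mx mxE.
have I20 q : ~ K q -> I2 q = 0.
  by move=> Kq; rewrite /I2 /form_inner diff0 // mul0mx mxE.
have J10 q : ~ K q -> J1 q = 0.
  by move=> /nK[p0 _]; rewrite /J1 p0 mulr0 mul0r.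
have J20 q : ~ K q -> J2 q = 0.
  by move=> /nK[p0 _]; rewrite /J2 p0 mulr0 mul0r.
have iI1 := integ _ cI1 I10; have iI2 := integ _ cI2 I20.
have iJ1 := integ _ cJ1 J10; have iJ2 := integ _ cJ2 J20.
(* [H] is half the right-hand side of [tested_equation], arranged so that formal adjointness applies
   to it. *)
pose H q := (I1 q + I2 q) - (J1 q + J2 q).
have cH : continuous H.
  by move=> q; apply: cvgB; apply: cvgD; [exact: cI1|exact: cI2|exact: cJ1|exact: cJ2].
have H0 q : ~ K q -> H q = 0.
  by move=> Kq; rewrite /H I10 // I20 // J10 // J20 // !addr0 subr0.
have intH : \int[vol]_q H q = 0.
  have iI : vol.-integrable setT (EFin \o (fun q => I1 q + I2 q)).
    apply: integ => q; first by apply: cvgD; [exact: cI1|exact: cI2].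
    by move=> Kq; rewrite I10 // I20 // addr0.
  have iJ : vol.-integrable setT (EFin \o (fun q => J1 q + J2 q)).
    apply: integ => q; first by apply: cvgD; [exact: cJ1|exact: cJ2].
    by move=> Kq; rewrite J10 // J20 // addr0.
  rewrite RintegralB //.
  (* Adjointness turns the integrals of [I1] and [I2] into those of [J1] and [J2]. *)
  rewrite !RintegralD // (Ha _ ta) (Hb _ tb).
  exact: subrr.
have HE q := tested_equation mg sf c (lap0 q).
have inner_ge0 q v : 0 <= covector_inner (g (chart_at A q) q) v v.
  have [->|v0] := eqVneq v 0; first by rewrite /covector_inner !mul0mx mxE.
  exact/ltW/covector_inner_gt0/v0/dom_chart_at.
have Hge0 q : 0 <= H q.
  rewrite -(pmulr_rge0 _ (ltr0Sn R 1)) [X in 0 <= X]HE.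
  by rewrite addr_ge0 // !mulr_ge0 ?addr_ge0 ?cutoff_ge0 ?cutoff_slope_ge0.
have du0 q : c < sq_norm f q ->
    covector_inner (g (chart_at A q) q) (diff_form (sq_norm f) (chart_at A q) q)
      (diff_form (sq_norm f) (chart_at A q) q) = 0.
  move=> qc; have qb : ~ boundary A q by move=> /bc; rewrite ltNge ltW.
  have Hq := integral0_interior hM mg hvol cH cK Kb H0 Hge0 intH qb.
  have := HE q; rewrite /= -/(H q).
  rewrite -[X in 2 * X]/(H q) Hq mulr0 => /esym/eqP.
  rewrite paddr_eq0 ?mulr_ge0 ?addr_ge0 ?cutoff_ge0 ?cutoff_slope_ge0 //.
  by rewrite mulf_eq0 gt_eqF ?cutoff_slope_gt0 //= => /andP[/eqP].
move=> p pc; apply: (zero_diff_form_locally_cst mg su).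
  by move=> /bc; rewrite ltNge ltW.
apply: filterS du0 _; exact: (cvgr_gt _ (cu p) _ pc).
Qed.

Theorem proposition1p1 (R : realType) (n : nat) (M : ptopologicalType)
    (A : atlas R n M) (g : bilinear_field A)
    (vol : {measure set (borel M) -> \bar R})
    (delta : covector_field A -> M -> R)
    (eta : covector_field A) (f : M -> R[i]) :
  hausdorff_space M -> compact [set: M] -> connected [set: M] ->
  boundary A !=set0 ->
  riemannian_metric g ->
  riemannian_volume g vol ->
  codifferential g vol delta ->
  one_form eta ->
  smooth_cfun A f ->
  (forall p, magnetic_laplacian g delta eta f p = 0) ->
  exists2 q, boundary A q & forall p, `|f p| <= `|f q|.
Proof.
move=> hM cM conM b0 mg hvol hdelta eta1 sf lap0.
have cu : continuous (sq_norm f) := smooth_fun_continuous (smooth_sq_norm sf).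
have cb : compact (boundary A).
  apply: (subclosed_compact _ cM) => //.
  by rewrite -[boundary A]setCK; exact: open_closedC (interior_open mg).
have [q bq maxq] := compact_EVT_max b0 cb (continuous_subspaceT cu).
rewrite inE in bq.
have [|p0 _ maxp] := compact_EVT_max _ cM (continuous_subspaceT cu).
  by case: b0 => z _; exists z.
exists q => // p; apply: ler_sq_norm.
apply: le_trans (maxp p _) _; first by rewrite inE.
rewrite leNgt; apply/negP => qp0.
(* The midpoint lies strictly between the maximum over the boundary and the maximum over [M]. *)
pose c := (sq_norm f q + sq_norm f p0) / 2.
have cp0 : c < sq_norm f p0 by rewrite /c; lra.
have bc z : boundary A z -> sq_norm f z < c.
  by move=> bz; have := maxq z; rewrite inE => /(_ bz); rewrite /c; lra.
have loc := sq_norm_locally_cst hM cM mg hvol hdelta eta1 sf lap0 bc.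
pose S : set M := [set z | sq_norm f z = sq_norm f p0].
(* The maximum set is open because [u] is locally constant above [c], and closed by continuity.
   Connectedness makes it contain the boundary point [q], a contradiction. *)
have ST : S = setT.
  apply: conM; first by exists p0.
    exists S; last by rewrite setTI.
    rewrite openE => z Sz; have := loc z; rewrite Sz => /(_ cp0).
    by apply: filterS.
  exists S; last by rewrite setTI.
  exact: (closed_comp (fun q _ => cu q) (@closed_eq R _)).
have : S q by rewrite ST.
by rewrite /S /= => Sq; move: qp0; rewrite Sq ltxx.
Qed.
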